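(* Model checking $\mathcal{L}_{\mathsf{EL}}$ on belief structures is PSPACE-hard. That is, the following problem is PSPACE-hard: given a finite set of agents $A$, a belief structure $\mathcal{F}=(V,\theta,\Omega)$ with $\theta$ and each $\Omega_i$ given as BDDs, a state $s$ of $\mathcal{F}$ and $\phi\in\mathcal{L}_{\mathsf{EL}}(V)$, decide whether $\mathcal{F},s\vDash\phi$ (input size $|V|+|\theta|+\sum_{i\in A}|\Omega_i|+|\phi|$, BDD sizes counted in nodes).
   Context: A vocabulary $V$ is a finite linearly ordered set of atoms; $A$ a finite set of agents; $V'=\{p'\mid p\in V\}$ is a fresh copy of $V$ and $t'=\{p'\mid p\in t\}$ for $t\subseteq V$. Boolean formulas over a vocabulary $W$: $\beta::=\top\mid\bot\mid p\mid\neg\beta\mid\beta\land\beta$; valuations are subsets of $W$ with ordinary satisfaction $\vDash$. BDDs are reduced ordered binary decision diagrams; size = number of nodes. $\mathcal{L}_{\mathsf{EL}}(V)$: $\phi::=\top\mid\bot\mid p\mid\neg\phi\mid\phi\land\phi\mid K_i\phi$ ($p\in V,i\in A$), with length $|\top|=|\bot|=|p|=1$, $|\neg\phi|=|K_i\phi|=|\phi|+1$, $|\phi_1\land\phi_2|=|\phi_1|+|\phi_2|+1$. A belief structure is $\mathcal{F}=(V,\theta,\Omega)$ with $\theta$ a Boolean function over $V$ (state law) and for each $i\in A$ an observation law $\Omega_i$, a Boolean function over $V\cup V'$. States of $\mathcal{F}$: $s\subseteq V$ with $s\vDash\theta$. Semantics: Boolean cases as usual ($p$ true iff $p\in s$);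 $\mathcal{F},s\vDash K_i\phi$ iff for all states $t$ of $\mathcal{F}$ with $s\cup t'\vDash\Omega_i$, $\mathcal{F},t\vDash\phi$. *)

(* Defs.v *)
From mathcomp Require Import all_boot all_order zify.

Set Implicit Arguments.
Unset Strict Implicit.
Unset Printing Implicit Defensive.

(** * Turing machines and PSPACE-hardness *)

Definition poly_bounded (f : nat -> nat) : Prop :=
  exists c, forall n, f n <= c * n ^ c + c.

Inductive move := MoveL | MoveR | Stay.

(* Deterministic machine with [tm_tapes.+1] one-way infinite tapes.  The tape
   alphabet is [option (bool + tm_aux)]: [None] is the blank, [Some (inl b)] an
   input/output bit, [Some (inr a)] an auxiliary symbol.  A control state [q] is
   halting, with verdict [b], iff [tm_halt q = Some b]. *)
Record tm : Type := Tm {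
  tm_tapes : nat;
  tm_aux : finType;
  tm_state : finType;
  tm_start : tm_state;
  tm_halt : tm_state -> option bool;
  tm_delta : tm_state -> {ffun 'I_tm_tapes.+1 -> option (bool + tm_aux)} ->
             tm_state * ('I_tm_tapes.+1 -> option (bool + tm_aux) * move)
}.

Section Machine.
Variable M : tm.

Definition tm_sym : Type := option (bool + tm_aux M).

Record tm_config : Type := TmConfig {
  cf_state : tm_state M;
  cf_head : 'I_(tm_tapes M).+1 -> nat;
  cf_tape : 'I_(tm_tapes M).+1 -> nat -> tm_sym
}.

Definition tape_of_word (w : seq bool) : nat -> tm_sym :=
  fun i => nth None [seq Some (inl b) | b <- w] i.

Definition tm_init (w : seq bool) : tm_config :=
  TmConfig (tm_start M) (fun=> 0)
    (fun j => if j == ord0 then tape_of_word w else fun=> None).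

(* A left move from cell 0 leaves the head in place. *)
Definition move_head (m : move) (h : nat) : nat :=
  match m with MoveL => h.-1 | MoveR => h.+1 | Stay => h end.

Definition tm_step (c : tm_config) : tm_config :=
  if tm_halt (cf_state c) is Some _ then c
  else
    let: (q, act) :=
      tm_delta (cf_state c) [ffun j => cf_tape c j (cf_head c j)] in
    TmConfig q
      (fun j => move_head (act j).2 (cf_head c j))
      (fun j i => if i == cf_head c j then (act j).1 else cf_tape c j i).

Definition tm_run (w : seq bool) (t : nat) : tm_config :=
  iter t tm_step (tm_init w).

Definition tm_decides (L : seq bool -> Prop) : Prop :=
  forall w, exists t b,
    tm_halt (cf_state (tm_run w t)) = Some b /\ (L w <-> b = true).

Definition tm_runs_in_space (S : nat -> nat) : Prop :=
  forall w t j, cf_head (tm_run w t) j < S (size w).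

(* The output is read off the last tape, which is also the input tape when the
   machine has a single tape. *)
Definition tm_computes_in_time (f : seq bool -> seq bool) (T : nat -> nat) :
    Prop :=
  forall w, exists t,
    [/\ t <= T (size w), tm_halt (cf_state (tm_run w t)) <> None
      & forall i, cf_tape (tm_run w t) ord_max i = tape_of_word (f w) i].

End Machine.

Definition PSPACE (L : seq bool -> Prop) : Prop :=
  exists (M : tm) (S : nat -> nat),
    [/\ poly_bounded S, tm_runs_in_space M S & tm_decides M L].

Definition polytime (f : seq bool -> seq bool) : Prop :=
  exists (M : tm) (T : nat -> nat),
    poly_bounded T /\ tm_computes_in_time M f T.

(* The encoding must be injective and of length polynomially related to the
   declared instance size. *)
Record decision_problem : Type := DecisionProblem {
  dp_instance : Type;
  dp_yes : dp_instance -> Prop;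
  dp_size : dp_instance -> nat;
  dp_encode : dp_instance -> seq bool;
  dp_encode_inj : injective dp_encode;
  dp_encode_le : exists2 p, poly_bounded p &
    forall x, size (dp_encode x) <= p (dp_size x);
  dp_encode_ge : exists2 p, poly_bounded p &
    forall x, dp_size x <= p (size (dp_encode x))
}.

(* Polynomial-time many-one reducibility.  The reduction yields a genuine
   instance of [P] on every word, not only on members of [L]. *)
Definition reduces_to (L : seq bool -> Prop) (P : decision_problem) : Prop :=
  exists f : seq bool -> dp_instance P,
    polytime (fun w => dp_encode (f w)) /\ forall w, L w <-> dp_yes (f w).

Definition PSPACE_hard (P : decision_problem) : Prop :=
  forall L, PSPACE L -> reduces_to L P.

(** * Epistemic formulas *)

Inductive EL (A V : Type) : Type :=
| Top
| Bot
| Atom of V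
| Neg of EL A V
| And of EL A V & EL A V
| Know of A & EL A V.
Arguments Top {A V}.
Arguments Bot {A V}.
Arguments Atom {A V} p.

Fixpoint EL_length (A V : Type) (phi : EL A V) : nat :=
  match phi with
  | Top | Bot | Atom _ => 1
  | Neg psi | Know _ psi => (EL_length psi).+1
  | And psi1 psi2 => (EL_length psi1 + EL_length psi2).+1
  end.

(** * Belief structures *)

(* V u V': [(p, false)] is p and [(p, true)] is p'.  The order is the
   lexicographic one, p < p' < q < q' for p < q in V. *)
Definition primed d (V : finOrderType d) := (V *l bool)%type.

(* s u t' *)
Definition pair_val d (V : finOrderType d) (s t : {set V}) : {set primed V} :=
  [set ((p, false) : primed V) | p in s] :|:
  [set ((p, true) : primed V) | p in t].

Record belief_structure (A : finType) d (V : finOrderType d) : Type :=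
  BeliefStructure {
    bs_law : {set V} -> bool;
    bs_obs : A -> {set primed V} -> bool
  }.

Definition bs_state (A : finType) d (V : finOrderType d)
    (F : belief_structure A V) (s : {set V}) : bool := bs_law F s.

Fixpoint sat (A : finType) d (V : finOrderType d) (F : belief_structure A V)
    (s : {set V}) (phi : EL A V) {struct phi} : bool :=
  match phi with
  | Top => true
  | Bot => false
  | Atom p => p \in s
  | Neg psi => ~~ sat F s psi
  | And psi1 psi2 => sat F s psi1 && sat F s psi2
  | Know i psi =>
      [forall t, bs_state F t && bs_obs F i (pair_val s t) ==> sat F t psi]
  end.

(** * Reduced ordered BDDs *)

Section BDD.
Context {d : Order.disp_t} {W : finOrderType d}.

(* [inl b] is a terminal; [inr (x, lo, hi)] tests x, going to lo if x is false
   and to hi if x is true. *)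
Definition bdd_node (k : nat) := (bool + W * 'I_k * 'I_k)%type.

Section Raw.
Variables (k : nat) (lab : {ffun 'I_k -> bdd_node k}).

Definition bdd_edge : rel 'I_k := fun i j =>
  if lab i is inr (_, lo, hi) then (j == lo) || (j == hi) else false.

Definition bdd_below (x : W) (j : 'I_k) : bool :=
  if lab j is inr (y, _, _) then (x < y)%O else true.

Definition bdd_ordered : bool :=
  [forall i, if lab i is inr (x, lo, hi) then bdd_below x lo && bdd_below x hi
             else true].

(* No redundant test, and no two nodes with the same variable and children (or
   terminals with the same value). *)
Definition bdd_reduced : bool :=
  [forall i, if lab i is inr (_, lo, hi) then lo != hi else true] &&
  injectiveb lab.

Definition bdd_walk (v : {set W}) (i : 'I_k) : 'I_k :=
  if lab i is inr (x, lo, hi) then (if x \in v then hi else lo) else i.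

End Raw.

Record bdd : Type := Bdd {
  bdd_size : nat;
  bdd_root : 'I_bdd_size;
  bdd_label : {ffun 'I_bdd_size -> bdd_node bdd_size};
  bdd_ok : [&& bdd_ordered bdd_label, bdd_reduced bdd_label
             & [forall i, connect (bdd_edge bdd_label) bdd_root i]]
}.

(* Every variable is tested at most once on a path, so #|W| steps reach a
   terminal: see [bdd_end_terminal]. *)
Definition bdd_end (B : bdd) (v : {set W}) : 'I_(bdd_size B) :=
  iter #|W| (bdd_walk (bdd_label B) v) (bdd_root B).

Definition bdd_fun (B : bdd) (v : {set W}) : bool :=
  bdd_label B (bdd_end B v) == inl true.

Lemma bdd_end_terminal (B : bdd) (v : {set W}) :
  exists b, bdd_label B (bdd_end B v) = inl b.
Proof.
case: B => k r lab ok; rewrite /bdd_end /=.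
have /and3P [/forallP ord _ _] := ok.
pose pot i := if lab i is inr (x, _, _) then #|[set y | (x <= y)%O]| else 0.
have potS i : pot (bdd_walk lab v i) <= (pot i).-1.
  have below x j : bdd_below lab x j -> pot j <= #|[set y | (x <= y)%O]|.-1.
    rewrite /bdd_below /pot; case: (lab j) => [//|[[y lo] hi]] xy.
    suff /proper_card : [set z | (y <= z)%O] \proper [set z | (x <= z)%O].
      by move=> h; lia.
    apply/properP; split.
      apply/subsetP => z; rewrite !inE.
      exact/Order.POrderTheory.le_trans/Order.POrderTheory.ltW.
    by exists x; rewrite !inE // Order.POrderTheory.lt_geF.
  have := ord i; rewrite /bdd_walk {2}/pot; case E: (lab i) => [b|[[x lo] hi]].
    by rewrite /pot E.
  by case/andP => h1 h2; case: ifP => _; apply: below.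
have potn n : pot (iter n (bdd_walk lab v) r) <= #|W| - n.
  elim: n => [|n IH] /=.
    rewrite subn0 /pot; case: (lab r) => // -[[x _] _]; exact: max_card.
  by apply: leq_trans (potS _) _; rewrite subnS -!subn1 leq_sub2r.
have := potn #|W|; rewrite subnn leqn0 /pot.
case E: (lab _) => [b|[[x lo] hi]]; first by exists b.
by rewrite cards_eq0 => /eqP/setP/(_ x); rewrite !inE Order.POrderTheory.lexx.
Qed.

End BDD.
Arguments bdd {d} W.

(** * The model checking problem *)

(* Agents and atoms are numbered: A = 'I_m, and V = 'I_n with its usual order. *)
Record mc_instance : Type := McInstance {
  mc_agents : nat;
  mc_atoms : nat;
  mc_law : bdd 'I_mc_atoms;
  mc_obs : {ffun 'I_mc_agents -> bdd (primed 'I_mc_atoms)};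
  mc_point : {set 'I_mc_atoms};
  mc_formula : EL 'I_mc_agents 'I_mc_atoms;
  mc_point_state : bdd_fun mc_law mc_point
}.

Definition mc_structure (I : mc_instance) :
    belief_structure 'I_(mc_agents I) 'I_(mc_atoms I) :=
  BeliefStructure (bdd_fun (mc_law I)) (fun i => bdd_fun (mc_obs I i)).

Definition mc_holds (I : mc_instance) : Prop :=
  sat (mc_structure I) (mc_point I) (mc_formula I).

Definition mc_size (I : mc_instance) : nat :=
  mc_atoms I + bdd_size (mc_law I) + \sum_i bdd_size (mc_obs I i)
  + EL_length (mc_formula I).

(* Instances are serialised as lists of numbers, in turn written in unary; since
   all numbers are linear in the instance size this costs only a polynomial. *)
Definition bits_of_nats (s : seq nat) : seq bool :=
  flatten [seq rcons (nseq a true) false | a <- s].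

Definition node_code d (W : finOrderType d) (vc : W -> nat) k
    (x : @bdd_node d W k) : seq nat :=
  match x with
  | inl b => [:: nat_of_bool b]
  | inr (x, lo, hi) => [:: 2; vc x; val lo; val hi]
  end.

Definition bdd_code d (W : finOrderType d) (vc : W -> nat) (B : bdd W) :
    seq nat :=
  [:: bdd_size B, val (bdd_root B)
    & flatten [seq node_code vc (bdd_label B i) | i <- enum 'I_(bdd_size B)]].

Arguments bdd_code : simpl never.

Definition primed_code n (x : primed 'I_n) : nat := (val x.1).*2 + x.2.

Fixpoint EL_code m n (phi : EL 'I_m 'I_n) : seq nat :=
  match phi with
  | Top => [:: 0]
  | Bot => [:: 1]
  | Atom p => [:: 2; val p]
  | Neg psi => 3 :: EL_code psi
  | And psi1 psi2 => 4 :: EL_code psi1 ++ EL_code psi2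
  | Know i psi => [:: 5, val i & EL_code psi]
  end.

Definition mc_code (I : mc_instance) : seq nat :=
  [:: mc_agents I, mc_atoms I
    & bdd_code (@nat_of_ord _) (mc_law I)
      ++ flatten [seq bdd_code (@primed_code _) (mc_obs I i)
                 | i <- enum 'I_(mc_agents I)]
      ++ [seq nat_of_bool (p \in mc_point I) | p <- enum 'I_(mc_atoms I)]
      ++ EL_code (mc_formula I)].

Definition mc_encode (I : mc_instance) : seq bool := bits_of_nats (mc_code I).

Lemma bits_of_nats_inj : injective bits_of_nats.
Proof.
have un a b r r' : rcons (nseq a true) false ++ r = rcons (nseq b true) false ++ r' ->
    a = b /\ r = r'.
  elim: a b => [|a IH] [|b] //= [] //.
  by move=> /IH [-> ->].
elim=> [|a s IH] [|b t] //=; try by case: a b => [|?] //; case.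
  by rewrite /bits_of_nats /=; case: b.
  by rewrite /bits_of_nats /=; case: a.
by rewrite /bits_of_nats /= => /un [-> /IH ->].
Qed.

Lemma size_bits_of_nats s : size (bits_of_nats s) = sumn s + size s.
Proof.
elim: s => //= a s IH; rewrite /bits_of_nats /= size_cat -/(bits_of_nats s) IH.
by rewrite size_rcons size_nseq; lia.
Qed.

Lemma prefix_flatten_inj (T : eqType) (U : T -> Type) (e : forall x, U x -> seq nat)
    (s : seq T) (f g : forall x, U x) r r' :
  (forall x (u v : U x) q q', e x u ++ q = e x v ++ q' -> u = v /\ q = q') ->
  flatten [seq e x (f x) | x <- s] ++ r = flatten [seq e x (g x) | x <- s] ++ r' ->
  (forall x, x \in s -> f x = g x) /\ r = r'.
Proof.
move=> ei; elim: s => [|x s IH] //=.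
rewrite -!catA => /ei [fx /IH [fs ->]]; split=> // y.
by rewrite inE => /orP [/eqP ->|/fs].
Qed.

Lemma bdd_code_inj d (W : finOrderType d) (vc : W -> nat) (B C : bdd W) r r' :
  injective vc -> bdd_code vc B ++ r = bdd_code vc C ++ r' -> B = C /\ r = r'.
Proof.
move=> vi; case: B => k rt l okB; case: C => k' rt' l' okC.
rewrite /bdd_code /= => -[ek].
subst k' => /val_inj er; subst rt'.
move/(@prefix_flatten_inj _ (fun=> bdd_node k) (fun _ => node_code vc (k := k))).
case=> [_ [b|[[x lo] hi]] [b'|[[x' lo'] hi']] q q' /=|].
- by case=> e ->; split=> //; case: b b' e => -[].
- by case: b.
- by case: b'.
- by case=> /vi -> /val_inj -> /val_inj -> ->.
move=> e ->; split=> //.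
have el : l = l' by apply/ffunP => i; apply: e; rewrite mem_enum.
by subst l'; congr Bdd; apply: bool_irrelevance.
Qed.

Lemma EL_code_inj m n (phi psi : EL 'I_m 'I_n) r r' :
  EL_code phi ++ r = EL_code psi ++ r' -> phi = psi /\ r = r'.
Proof.
elim: phi psi r r' => [||p|phi IH|phi1 IH1 phi2 IH2|i phi IH] [||p'|psi|psi1 psi2|i' psi] //= r r'.
- by case=> ->.
- by case=> ->.
- by case=> /val_inj -> ->.
- by case=> /IH [-> ->].
- by rewrite -!catA => -[/IH1 [-> /IH2 [-> ->]]].
- by case=> /val_inj -> /IH [-> ->].
Qed.

Lemma primed_code_inj n : injective (@primed_code n).
Proof.
move=> [p b] [q c]; rewrite /primed_code /= => e.
have [e1 e2] : (p = q :> nat) /\ b = c.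
  by case: b c e => -[] /= e; split=> //; lia.
by rewrite e2 (val_inj e1).
Qed.

Lemma mc_encode_inj : injective mc_encode.
Proof.
move=> [m n th om s phi ok] [m' n' th' om' s' phi' ok'] /bits_of_nats_inj.
rewrite /mc_code.
have cons2 (a a' b b' : nat) q q' : [:: a, b & q] = [:: a', b' & q'] ->
    [/\ a = a', b = b' & q = q'] by case=> -> -> ->.
case/cons2 => /= em en.
subst m' n' => /bdd_code_inj [|eth]; first exact: val_inj.
move/(@prefix_flatten_inj _ (fun=> bdd (primed 'I_n))
        (fun _ => bdd_code (@primed_code n))).
case=> [_ B C q q'|eom]; first by apply: bdd_code_inj; apply: primed_code_inj.
have flat (u : {set 'I_n}) : [seq nat_of_bool (p \in u) | p <- enum 'I_n] =
    flatten [seq [:: nat_of_bool (p \in u)] | p <- enum 'I_n].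
  by elim: (enum _) => //= p l ->.
rewrite !flat => /(@prefix_flatten_inj _ (fun=> bool) (fun _ b => [:: nat_of_bool b])).
case=> [_ b c q q' [e ->]|es]; first by split=> //; case: b c e => -[].
rewrite -[EL_code phi]cats0 -[EL_code phi']cats0 => /EL_code_inj [ephi _].
have {}eom : om = om' by apply/ffunP => i; apply: eom; rewrite mem_enum.
have {}es : s = s' by apply/setP => i; apply: es; rewrite mem_enum.
by subst; congr McInstance; apply: bool_irrelevance.
Qed.

Lemma size_bdd_code d (W : finOrderType d) (vc : W -> nat) (B : bdd W) :
  bdd_size B <= size (bdd_code vc B) <= 4 * bdd_size B + 2.
Proof.
case: B => k rt l ok; rewrite /bdd_code /= size_flatten sumnE big_map big_map.
have h i : 1 <= size (node_code vc (l i)) <= 4.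
  by case: (l i) => [b|[[x lo] hi]].
have le a b (g : 'I_k -> nat) : (forall i, a <= g i <= b) ->
    a * k <= \sum_(i <- enum 'I_k) g i <= b * k.
  move=> hg; rewrite big_enum /=.
  have cst c : c * k = \sum_(i in 'I_k) c by rewrite sum_nat_const card_ord mulnC.
  by rewrite !cst; apply/andP; split; apply: leq_sum => i _; case/andP: (hg i).
have /andP [] := le _ _ _ h; move: (bigop _ _ _) => z; lia.
Qed.

Lemma all_bdd_code d (W : finOrderType d) (vc : W -> nat) (B : bdd W) b :
  2 <= b -> bdd_size B <= b -> (forall x, vc x <= b) ->
  all (leq^~ b) (bdd_code vc B).
Proof.
case: B => k rt l ok b2 kb vb; rewrite /bdd_code /=.
have ob (i : 'I_k) : i <= b := leq_trans (ltnW (ltn_ord i)) kb.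
move: kb => /= ->; rewrite ob /=.
apply/allP => a /flatten_mapP [i _]; case: (l i) => [c|[[x lo] hi]] /=.
  by rewrite inE => /eqP ->; case: c; lia.
by rewrite !inE => /or4P [] /eqP -> //.
Qed.

Lemma size_EL_code m n (phi : EL 'I_m 'I_n) :
  EL_length phi <= size (EL_code phi) <= 2 * EL_length phi.
Proof.
elim: phi => //= [phi IH|phi1 IH1 phi2 IH2|i phi IH]; rewrite ?size_cat; lia.
Qed.

Lemma all_EL_code m n (phi : EL 'I_m 'I_n) b :
  5 <= b -> m <= b -> n <= b -> all (leq^~ b) (EL_code phi).
Proof.
move=> b5 mb nb; elim: phi => /= [||p|phi ->|phi1 IH1 phi2 IH2|i phi ->].
- by [].
- by lia.
- by have := ltn_ord p; lia.
- by lia.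
- by rewrite all_cat IH1 IH2; lia.
- by have := ltn_ord i; lia.
Qed.

Lemma size_mc_obs_code (I : mc_instance) :
  mc_agents I <= \sum_i bdd_size (mc_obs I i) /\
  \sum_i bdd_size (mc_obs I i)
    <= size (flatten [seq bdd_code (@primed_code _) (mc_obs I i)
                     | i <- enum 'I_(mc_agents I)])
    <= 6 * \sum_i bdd_size (mc_obs I i).
Proof.
have pos i : 0 < bdd_size (mc_obs I i).
  exact: leq_ltn_trans (leq0n _) (ltn_ord (bdd_root (mc_obs I i))).
rewrite size_flatten sumnE big_map big_map big_enum; split.
  by rewrite -[X in X <= _]card_ord -sum1_card; apply: leq_sum.
rewrite big_distrr; apply/andP; split; apply: leq_sum => i _;
  have := size_bdd_code (@primed_code _) (mc_obs I i); have := pos i;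
  move: (size _) (bdd_size _) => b a /=; lia.
Qed.

Lemma size_mc_code I :
  size (mc_code I) =
    (size (bdd_code (@nat_of_ord _) (mc_law I))
     + (size (flatten [seq bdd_code (@primed_code _) (mc_obs I i)
                      | i <- enum 'I_(mc_agents I)])
        + (mc_atoms I + size (EL_code (mc_formula I))))).+2.
Proof.
rewrite /mc_code; move: (bdd_code _ _) (flatten _) (EL_code _) => a b c.
by rewrite /= !size_cat size_map size_enum_ord.
Qed.

Lemma size_mc_encode_ge I : mc_size I <= size (mc_encode I).
Proof.
rewrite /mc_encode size_bits_of_nats size_mc_code /mc_size.
have := size_bdd_code (@nat_of_ord _) (mc_law I).
have := size_EL_code (mc_formula I).
have [_] := size_mc_obs_code I.
move: (size (flatten _)) (size (bdd_code _ _)) (sumn _) (\sum_i _) => a b c e.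
by move: (bdd_size _) => k; lia.
Qed.

Lemma size_mc_encode_le I :
  size (mc_encode I) <= (6 * mc_size I + 4) * (2 * mc_size I + 6).
Proof.
have bnd b s : all (leq^~ b) s -> sumn s + size s <= size s * b.+1.
  by elim: s => //= a s IH /andP [ab /IH]; lia.
have [agents obs] := size_mc_obs_code I.
have law := size_bdd_code (@nat_of_ord _) (mc_law I).
have form := size_EL_code (mc_formula I).
have m_le : mc_agents I <= mc_size I.
  by move: agents; rewrite /mc_size; move: (\sum_i _) => e; lia.
rewrite /mc_encode size_bits_of_nats.
apply: leq_trans (bnd (2 * mc_size I + 5) _ _) _; last first.
  rewrite -addnS; apply: leq_mul => //.
  move: obs law form; rewrite size_mc_code /mc_size.
  move: (size (flatten _)) (size (bdd_code _ _)) (\sum_i _) => a b e.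
  by move: (bdd_size _) => k; lia.
have n_le : mc_atoms I <= mc_size I by rewrite /mc_size; lia.
have lawS : bdd_size (mc_law I) <= mc_size I by rewrite /mc_size; move: (bdd_size _) => k; lia.
have obsS i : bdd_size (mc_obs I i) <= mc_size I.
  by rewrite /mc_size (bigD1 i) //=; move: (\sum_(_ | _) _) => e; lia.
move: (mc_size I) m_le n_le lawS obsS => N m_le n_le lawS obsS.
have lawA : all (leq^~ (2 * N + 5)) (bdd_code (@nat_of_ord _) (mc_law I)).
  apply: all_bdd_code; [lia|by apply: leq_trans lawS _; lia|].
  by move=> x; have := ltn_ord x; lia.
have formA : all (leq^~ (2 * N + 5)) (EL_code (mc_formula I)).
  by apply: all_EL_code; lia.
have obsA i : all (leq^~ (2 * N + 5)) (bdd_code (@primed_code _) (mc_obs I i)).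
  apply: all_bdd_code; [lia|by apply: leq_trans (obsS i) _; lia|].
  by case=> p c; rewrite /primed_code /=; have := ltn_ord p; case: c; lia.
have flatA : all (leq^~ (2 * N + 5))
    (flatten [seq bdd_code (@primed_code _) (mc_obs I i)
             | i <- enum 'I_(mc_agents I)]).
  by apply/allP => a /flatten_mapP [i _]; move: a; apply/allP.
have pointA : all (leq^~ (2 * N + 5))
    [seq nat_of_bool (p \in mc_point I) | p <- enum 'I_(mc_atoms I)].
  by apply/allP => a /mapP [p _ ->]; case: (_ \in _); lia.
have cons2 (P : pred nat) a b s :
    P a -> P b -> all P s -> all P [:: a, b & s] by move=> /= -> ->.
apply: cons2; [lia|lia|].
by rewrite !all_cat lawA flatA pointA formA.
Qed.

Lemma mc_encode_poly_le : exists2 p, poly_bounded p &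
  forall I, size (mc_encode I) <= p (mc_size I).
Proof.
exists (fun n => (6 * n + 4) * (2 * n + 6)); last exact: size_mc_encode_le.
exists 80 => -[|n]; first by lia.
have : n.+1 ^ 2 <= n.+1 ^ 80 by apply: leq_pexp2l.
move: (_ ^ 80) => e; rewrite -mulnn; nia.
Qed.

Lemma mc_encode_poly_ge : exists2 p, poly_bounded p &
  forall I, mc_size I <= p (size (mc_encode I)).
Proof.
exists id; last exact: size_mc_encode_ge.
by exists 1 => n; rewrite expn1; lia.
Qed.

Definition EL_model_checking : decision_problem :=
  @DecisionProblem mc_instance mc_holds mc_size mc_encode
    mc_encode_inj mc_encode_poly_le mc_encode_poly_ge.

(* Main.v *)
From Stdlib Require Import FunctionalExtensionality.
From mathcomp Require Import all_boot all_order zify.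
Require Import Defs.

Set Implicit Arguments.
Unset Strict Implicit.
Unset Printing Implicit Defensive.

(** A deterministic machine running in space P has configurations of B = K P
bits, so if it halts it does so within 2^B steps.  Savitch's halving of paths
expresses "Y is the configuration 2^B steps after X" by B nested levels, each
of the form: some midpoint Z exists such that for both pairs (U, V) = (X, Z)
and (U, V) = (Z, Y), reloading (U, V) into (X, Y) makes the next level true.
A state of the belief structure carries the five blocks X, Y, Z, U, V, and
each quantifier is the modality of an agent who observes exactly the blocks to
be kept; its observation law is an equality on an interval of atoms, which has
a linear-size BDD for the order p < p' < q < q'.  The innermost formula is the
Boolean statement that Y is the successor of X.

The reduction is computed in polynomial time because the serialised instance
is printed by nested bounded loops over numbers polynomial in the input
length.  Such loop programs are compiled to programs over unary counters, and
these are Turing machines with one tape per counter. *)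

(** * Counter programs and their Turing machines *)

(** Writing the two halves of a path as two subformulas would double the formula at every level.
    Quantifying over the pair (U, V) leaves a single occurrence of the next level, so the formula
    grows linearly with the depth. The detour through U and V has a second cause: as p is tested
    right next to its own p', a small diagram can say that a block is kept, whereas moving one block
    to another would compare distant atoms, which is expensive in this order. Hence values are
    copied by Boolean equalities inside one state, and the modalities only keep or forget blocks.
    The state law is true everywhere. States whose blocks encode nothing are harmless: once X
    encodes a configuration of the run, determinism forces the midpoint. Halting configurations are
    fixed by [tm_step], so one may ask for exactly 2^B steps, and the verdict is read off Y. The
    number 2^B itself is never computed; only B levels are printed. *)

Inductive act := Nop | Inc of nat | Dec of nat | Put of bool | InR | InL.

Inductive test := NonZero of nat | NonBlank | InBit.

Inductive cmd :=
| Do of act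
| Seq of cmd & cmd
| If of test & cmd & cmd
| While of test & cmd.

Record store := Store { reg : nat -> nat; pos : nat; out : seq bool }.

Definition set_reg (f : nat -> nat) r k := fun x => if x == r then k else f x.

Definition perform (a : act) (s : store) : store :=
  match a with
  | Nop => s
  | Inc r => Store (set_reg (reg s) r (reg s r).+1) (pos s) (out s)
  | Dec r => Store (set_reg (reg s) r (reg s r).-1) (pos s) (out s)
  | Put b => Store (reg s) (pos s) (rcons (out s) b)
  | InR => Store (reg s) (pos s).+1 (out s)
  | InL => Store (reg s) (pos s).-1 (out s)
  end.

Definition check (w : seq bool) (s : store) (t : test) : bool :=
  match t with
  | NonZero r => reg s r != 0
  | NonBlank => pos s < size w
  | InBit => nth false w (pos s)
  end.

(** The last index is the exact number of machine steps: one for each action and one for each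
    test. *)
Inductive eval (w : seq bool) : cmd -> store -> store -> nat -> Prop :=
| EvalDo a s : eval w (Do a) s (perform a s) 1
| EvalSeq c1 c2 s1 s2 s3 t1 t2 :
    eval w c1 s1 s2 t1 -> eval w c2 s2 s3 t2 ->
    eval w (Seq c1 c2) s1 s3 (t1 + t2)
| EvalIf b c1 c2 s s' t :
    eval w (if check w s b then c1 else c2) s s' t ->
    eval w (If b c1 c2) s s' t.+1
| EvalWhileF b c s : ~~ check w s b -> eval w (While b c) s s 1
| EvalWhileT b c s1 s2 s3 t1 t2 :
    check w s1 b -> eval w c s1 s2 t1 -> eval w (While b c) s2 s3 t2 ->
    eval w (While b c) s1 s3 (t1 + t2).+1.

(** Program counters, built by recursion on the command so that they form a finite set of control
    states; the [None] of an option is the moment of the test. *)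
Fixpoint point (c : cmd) : finType :=
  match c with
  | Do _ => unit
  | Seq c1 c2 => (point c1 + point c2)%type
  | If _ c1 c2 => option (point c1 + point c2)%type
  | While _ c1 => option (point c1)
  end.

Fixpoint entry (c : cmd) : point c :=
  match c with
  | Do _ => tt
  | Seq c1 c2 => inl (entry c1)
  | If _ _ _ => None
  | While _ _ => None
  end.

(** A next point [None] means that control leaves the command. The answers to the tests are a
    parameter, so that stores and tapes can be run through the same function. *)
Fixpoint next (chk : test -> bool) (c : cmd) : point c -> option (point c) * act :=
  match c return point c -> option (point c) * act with
  | Do a => fun=> (None, a)
  | Seq c1 c2 => fun p =>
      match p with
      | inl p1 => let: (p', a) := next chk p1 in
                  (Some (if p' is Some p1' then inl p1' else inr (entry c2)), a)
      | inr p2 => let: (p', a) := next chk p2 in (omap inr p', a)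
      end
  | If b c1 c2 => fun p =>
      match p with
      | None => (Some (Some (if chk b then inl (entry c1) else inr (entry c2))),
                 Nop)
      | Some (inl p1) => let: (p', a) := next chk p1 in
                         (omap (fun x => Some (inl x)) p', a)
      | Some (inr p2) => let: (p', a) := next chk p2 in
                         (omap (fun x => Some (inr x)) p', a)
      end
  | While b c1 => fun p =>
      match p with
      | None => (if chk b then Some (Some (entry c1)) else None, Nop)
      | Some p1 => let: (p', a) := next chk p1 in (Some p', a)
      end
  end.

Inductive exits (w : seq bool) (c : cmd) : point c -> store -> store -> nat -> Prop :=
| ExitNow p s a : next (check w s) p = (None, a) -> exits w p s (perform a s) 1
| ExitLater p p' s s' a t : next (check w s) p = (Some p', a) ->
    exits w p' (perform a s) s' t -> exits w p s s' t.+1.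

Lemma exits_seq w c1 c2 (p : point c1) s1 s2 s3 t1 t2 :
  exits w p s1 s2 t1 -> exits w (entry c2) s2 s3 t2 ->
  exits w (c := Seq c1 c2) (inl p) s1 s3 (t1 + t2).
Proof.
move=> h h2.
have hr q s s' t : exits w q s s' t -> exits w (c := Seq c1 c2) (inr q) s s' t.
  elim=> {q s s' t} [q s a e|q q' s s' a t e _ IH].
    by apply: ExitNow; rewrite /= e.
  by apply: ExitLater IH; rewrite /= e.
elim: h h2 => {p s1 s2 t1} [p s a e|p p' s s' a t e _ IH] h2.
  by rewrite add1n; apply: ExitLater (hr _ _ _ _ h2); rewrite /= e.
by rewrite addSn; apply: ExitLater (IH h2); rewrite /= e.
Qed.

Lemma exits_if_l w b c1 c2 (p : point c1) s s' t :
  exits w p s s' t -> exits w (c := If b c1 c2) (Some (inl p)) s s' t.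
Proof.
elim=> {p s s' t} [p s a e|p p' s s' a t e _ IH].
  by apply: ExitNow; rewrite /= e.
by apply: ExitLater IH; rewrite /= e.
Qed.

Lemma exits_if_r w b c1 c2 (p : point c2) s s' t :
  exits w p s s' t -> exits w (c := If b c1 c2) (Some (inr p)) s s' t.
Proof.
elim=> {p s s' t} [p s a e|p p' s s' a t e _ IH].
  by apply: ExitNow; rewrite /= e.
by apply: ExitLater IH; rewrite /= e.
Qed.

Lemma exits_while w b c (p : point c) s1 s2 s3 t1 t2 :
  exits w p s1 s2 t1 -> exits w (c := While b c) None s2 s3 t2 ->
  exits w (c := While b c) (Some p) s1 s3 (t1 + t2).
Proof.
move=> h h2; elim: h h2 => {p s1 s2 t1} [p s a e|p p' s s' a t e _ IH] h2.
  by rewrite add1n; apply: ExitLater h2; rewrite /= e.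
by rewrite addSn; apply: ExitLater (IH h2); rewrite /= e.
Qed.

Lemma eval_exits w c s s' t : eval w c s s' t -> exits w (entry c) s s' t.
Proof.
elim=> {c s s' t} /=.
- by move=> a s; apply: ExitNow.
- by move=> c1 c2 s1 s2 s3 t1 t2 _ h1 _ h2; apply: exits_seq h1 h2.
- move=> b c1 c2 s s' t _.
  case E: (check w s b) => h; (apply: ExitLater; first by rewrite /= E).
    exact: exits_if_l.
  exact: exits_if_r.
- by move=> b c s /negbTE E; apply: (ExitNow (a := Nop)); rewrite /= E.
- move=> b c s1 s2 s3 t1 t2 E _ h1 _ h2.
  apply: (ExitLater (a := Nop)); first by rewrite /= E.
  exact: exits_while h1 h2.
Qed.

Definition act_bound (a : act) : nat :=
  match a with Inc r | Dec r => r.+1 | _ => 0 end.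

Definition test_bound (t : test) : nat :=
  if t is NonZero r then r.+1 else 0.

Fixpoint cmd_bound (c : cmd) : nat :=
  match c with
  | Do a => act_bound a
  | Seq c1 c2 => maxn (cmd_bound c1) (cmd_bound c2)
  | If b c1 c2 => maxn (test_bound b) (maxn (cmd_bound c1) (cmd_bound c2))
  | While b c1 => maxn (test_bound b) (cmd_bound c1)
  end.

Lemma next_bound chk c (p : point c) : act_bound (next chk p).2 <= cmd_bound c.
Proof.
elim: c p => [a|c1 IH1 c2 IH2|b c1 IH1 c2 IH2|b c IH] //=.
- case=> p; [have := IH1 p|have := IH2 p]; case: (next _ _) => q a /=; lia.
- case=> [[p|p]|] /=; [have := IH1 p|have := IH2 p|lia];
    case: (next _ _) => q a /=; lia.
- case=> [p|] /=; [have := IH p|lia]; case: (next _ _) => q a /=; lia.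
Qed.

(** The tapes represent only the registers below [cmd_bound c], so tests on tapes and on stores can
    be compared for those alone. *)
Lemma eq_next chk1 chk2 c (p : point c) :
  (forall t, test_bound t <= cmd_bound c -> chk1 t = chk2 t) ->
  next chk1 p = next chk2 p.
Proof.
elim: c p => [a|c1 IH1 c2 IH2|b c1 IH1 c2 IH2|b c IH] //= p e.
- by case: p => p; [rewrite IH1|rewrite IH2] => // t ht; apply: e; lia.
- case: p => [[p|p]|]; [rewrite IH1|rewrite IH2|rewrite e] => //; try lia;
    by move=> t ht; apply: e; lia.
- case: p => [p|]; [rewrite IH|rewrite e] => //; try lia;
    by move=> t ht; apply: e; lia.
Qed.

Lemma tape_of_wordE (M : tm) w i :
  tape_of_word M w i = if i < size w then Some (inl (nth false w i)) else None.
Proof.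
rewrite /tape_of_word; case: ltnP => h; first by rewrite (nth_map false).
by rewrite nth_default // size_map.
Qed.

(* Tape 0 holds the input, tape [r.+1] the register [r], whose value is the
   position of the head to the right of a mark in cell 0, and the last tape the
   output. *)
Section CommandMachine.
Variables (c : cmd).
Let R := cmd_bound c.
Let sym : finType := option (bool + void).

Definition tape_act (a : act) (g : {ffun 'I_R.+2 -> sym}) (j : 'I_R.+2) :
    sym * move :=
  match a with
  | Nop => (g j, Stay)
  | Inc r => (g j, if nat_of_ord j == r.+1 then MoveR else Stay)
  | Dec r => (g j, if nat_of_ord j == r.+1 then MoveL else Stay)
  | Put b => if nat_of_ord j == R.+1 then (Some (inl b), MoveR) else (g j, Stay)
  | InR => (g j, if nat_of_ord j == 0 then MoveR else Stay)
  | InL => (g j, if nat_of_ord j == 0 then MoveL else Stay)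
  end.

(** A register is zero exactly when its head reads the mark, all other cells of its tape being
    blank. A left move from cell 0 stays in place, which matches the truncated [Dec]. *)
Definition tape_check (g : {ffun 'I_R.+2 -> sym}) (t : test) : bool :=
  match t with
  | NonZero r => g (inord r.+1) == None
  | NonBlank => g ord0 != None
  | InBit => g ord0 == Some (inl true)
  end.

(* [None] is the start, where the registers are marked, and [Some None] the
   halting state. *)
Definition cmd_delta (p : option (option (point c))) (g : {ffun 'I_R.+2 -> sym}) :
    option (option (point c)) * ('I_R.+2 -> sym * move) :=
  match p with
  | None => (Some (Some (entry c)),
             fun j => (if (nat_of_ord j == 0) || (nat_of_ord j == R.+1) then g j
                       else Some (inl true), Stay))
  | Some None => (p, fun j => (g j, Stay))
  | Some (Some p') => let: (p1, a) := next (tape_check g) p' in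
                      (Some p1, tape_act a g)
  end.

Definition cmd_tm : tm :=
  @Tm R.+1 void (option (option (point c))) None
    (fun p => if p is Some None then Some true else None) cmd_delta.

Definition store_head (s : store) (j : 'I_R.+2) : nat :=
  if nat_of_ord j == 0 then pos s
  else if nat_of_ord j == R.+1 then size (out s) else reg s j.-1.

Definition store_tape (w : seq bool) (s : store) (j : 'I_R.+2) (i : nat) :
    tm_sym cmd_tm :=
  if nat_of_ord j == 0 then tape_of_word cmd_tm w i
  else if nat_of_ord j == R.+1 then tape_of_word cmd_tm (out s) i
  else if i == 0 then Some (inl true) else None.

Definition store_conf w p s : tm_config cmd_tm :=
  @TmConfig cmd_tm p (store_head s) (store_tape w s).

Lemma tape_checkE w s t : test_bound t <= R ->
  tape_check [ffun j => store_tape w s j (store_head s j)] t = check w s t.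
Proof.
case: t => [r|_|_] /=; rewrite ffunE /store_tape /store_head.
- move=> h; rewrite inordK; last by lia.
  rewrite /= eqSS; case: (r =P R) => [|_]; first lia.
  by case: (reg s r).
- by rewrite /= tape_of_wordE; case: ifP.
(* Past the end of the input the head reads a blank, and the default value of [nth] is false as
   well. *)
- rewrite /= tape_of_wordE; case: ifP => [_|/negbT]; first by case: nth.
  by rewrite -leqNgt => h; rewrite nth_default.
Qed.

Lemma cmd_step w p s :
  tm_step (store_conf w (Some (Some p)) s) =
  let: (p', a) := next (check w s) p in store_conf w (Some p') (perform a s).
Proof.
rewrite /tm_step /=.
rewrite (eq_next (chk2 := check w s)); last by move=> t; apply: tape_checkE.
have := next_bound (check w s) p; case: (next _ _) => p' a /= ha.
congr TmConfig.
  apply: functional_extensionality => j; rewrite /store_head.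
  case: a ha => [|r|r|b||] /= ha //; rewrite /set_reg.
  - case: (nat_of_ord j =P 0) => [->|j0] //=.
    case: (nat_of_ord j =P R.+1) => [jR|_];
      case: (nat_of_ord j =P r.+1) => [jr|jr] //=; first lia.
      by rewrite jr /= eqxx.
    by case: (j.-1 =P r) => // ?; lia.
  - case: (nat_of_ord j =P 0) => [->|j0] //=.
    case: (nat_of_ord j =P R.+1) => [jR|_];
      case: (nat_of_ord j =P r.+1) => [jr|jr] //=; first lia.
      by rewrite jr /= eqxx.
    by case: (j.-1 =P r) => // ?; lia.
  - case: (nat_of_ord j =P 0) => [->|j0] //=.
    by case: eqP => //= _; rewrite size_rcons.
  - by case: eqP.
  - by case: eqP.
apply: functional_extensionality => j; apply: functional_extensionality => i.
(* Every action but [Put] writes back the symbol that it reads. *)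
have keep : (if i == store_head s j then store_tape w s j (store_head s j)
             else store_tape w s j i) = store_tape w s j i by case: eqP => [->|].
case: a ha => [|r|r|b||] /= ha; rewrite ?ffunE ?keep //.
case: (nat_of_ord j =P R.+1) => [jR|jR]; last first.
  rewrite /= keep /store_tape; case: (nat_of_ord j =P 0) => // _.
  by case: (nat_of_ord j =P R.+1).
rewrite /store_tape /store_head jR eqxx /= !tape_of_wordE size_rcons nth_rcons.
by case: ltngtP => h; rewrite ?ltnS ?(ltnW h) //; [rewrite leqNgt h| rewrite h leqnn].
Qed.

Lemma cmd_exits w p s s' t : exits w (c := c) p s s' t ->
  iter t (@tm_step cmd_tm) (store_conf w (Some (Some p)) s) =
  store_conf w (Some None) s'.
Proof.
elim=> {p s s' t} [p s a e|p p' s s' a t e _ IH].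
  by rewrite [iter 1 _ _]/= cmd_step e.
by rewrite iterSr cmd_step e.
Qed.

Lemma cmd_start w :
  tm_step (tm_init cmd_tm w) =
  store_conf w (Some (Some (entry c))) (Store (fun=> 0) 0 [::]).
Proof.
rewrite /tm_step /=; congr TmConfig; apply: functional_extensionality => j.
  by rewrite /store_head /=; case: eqP => // _; case: eqP.
apply: functional_extensionality => i; rewrite /store_tape ffunE.
have -> : (j == ord0) = (nat_of_ord j == 0) by [].
case: (nat_of_ord j =P 0) => [_|j0] /=; first by case: eqP => [->|].
case: (nat_of_ord j =P R.+1) => [_|jR] //=.
by rewrite tape_of_wordE /=; case: eqP.
Qed.

Lemma cmd_tm_computes (f : seq bool -> seq bool) (T : nat -> nat) :
  (forall w, exists s t,
     [/\ t <= T (size w), eval w c (Store (fun=> 0) 0 [::]) s t & out s = f w]) ->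
  tm_computes_in_time cmd_tm f (fun n => (T n).+1).
Proof.
move=> h w; have [s [t [tT /eval_exits/cmd_exits e fw]]] := h w.
exists t.+1; rewrite /tm_run iterSr cmd_start e; split=> // i.
by rewrite /= /store_tape /= eqxx fw.
Qed.

End CommandMachine.

(** * Polynomial time bounds *)

Lemma poly_bounded_expn c : poly_bounded (fun n => n.+2 ^ c).
Proof.
exists (3 ^ c + c) => -[|n].
  have : 2 ^ c <= 3 ^ c by case: c => // c; rewrite leq_exp2r.
  by lia.
have h : n.+3 ^ c <= 3 ^ c * n.+1 ^ c.
  by rewrite -expnMn; case: c => // c; rewrite leq_exp2r //; lia.
have h2 : n.+1 ^ c <= n.+1 ^ (3 ^ c + c) by rewrite leq_pexp2l //; lia.
apply: leq_trans h _; apply: leq_trans (leq_addr _ _).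
by apply: leq_mul => //; lia.
Qed.

Lemma cmd_polytime (c : cmd) (k : nat) (f : seq bool -> seq bool) :
  (forall w, exists s t,
     [/\ t <= (size w).+2 ^ k, eval w c (Store (fun=> 0) 0 [::]) s t
       & out s = f w]) ->
  polytime f.
Proof.
move=> h; exists (cmd_tm c), (fun n => (n.+2 ^ k).+1); split.
  have [e he] := poly_bounded_expn k.+1; exists e => n.
  apply: leq_trans (he n); rewrite expnS.
  have : 0 < n.+2 ^ k by rewrite expn_gt0.
  by move: (_ ^ _) => x; nia.
exact: cmd_tm_computes.
Qed.

(** * Running times of counter programs *)

Definition runs w c s s' T := exists2 t, t <= T & eval w c s s' t.

Lemma runs_le w c s s' T T' : runs w c s s' T -> T <= T' -> runs w c s s' T'.
Proof. by case=> t tT h TT; exists t => //; apply: leq_trans TT. Qed.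

Lemma runs_do w a s : runs w (Do a) s (perform a s) 1.
Proof. by exists 1 => //; constructor. Qed.

Lemma runs_seq w c1 c2 s1 s2 s3 T1 T2 :
  runs w c1 s1 s2 T1 -> runs w c2 s2 s3 T2 -> runs w (Seq c1 c2) s1 s3 (T1 + T2).
Proof.
case=> t1 h1 e1 [t2 h2 e2]; exists (t1 + t2); first exact: leq_add.
exact: EvalSeq e1 e2.
Qed.

Lemma runs_if w b c1 c2 s s' T :
  runs w (if check w s b then c1 else c2) s s' T -> runs w (If b c1 c2) s s' T.+1.
Proof. by case=> t h e; exists t.+1 => //; constructor. Qed.

Lemma runs_while w b c (S : nat -> store) T k :
  (forall i, i < k -> check w (S i) b) -> ~~ check w (S k) b ->
  (forall i, i < k -> runs w c (S i) (S i.+1) T) ->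
  runs w (While b c) (S 0) (S k) (k * T.+1 + 1).
Proof.
elim: k S => [|k IH] S h1 h2 h3; first by exists 1 => //; constructor.
have [t1 tT e1] := h3 0 isT.
have [i ik|//|i ik|t2 tT2 e2] := IH (S \o succn).
- exact: (h1 i.+1).
- exact: (h3 i.+1).
exists (t1 + t2).+1; first by lia.
by apply: EvalWhileT (h1 0 isT) e1 e2.
Qed.

Lemma runs_loop w r c (S : nat -> store) T k :
  (forall i, i <= k -> reg (S i) r = k - i) ->
  (forall i, i < k -> runs w c (perform (Dec r) (S i)) (S i.+1) T) ->
  runs w (While (NonZero r) (Seq (Do (Dec r)) c)) (S 0) (S k) (k * T.+2 + 1).
Proof.
move=> h1 h2; apply: runs_while => [i ik||i ik] /=.
- by rewrite h1; lia.
- by rewrite h1 // subnn.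
- by rewrite -add1n; apply: runs_seq (runs_do _ _ _) (h2 i ik).
Qed.

Lemma storeE s s' : (forall r, reg s r = reg s' r) -> pos s = pos s' ->
  out s = out s' -> s = s'.
Proof.
case: s => f p o; case: s' => f' p' o' /= e -> ->.
by congr Store; apply: functional_extensionality.
Qed.

Lemma set_reg_eq f r k : set_reg f r k r = k.
Proof. by rewrite /set_reg eqxx. Qed.

Definition touches (a : act) (r : nat) : bool :=
  match a with Inc x | Dec x => x == r | _ => false end.

Definition shift r x k s :=
  Store (fun y => if y == r then reg s r - k
                  else if y == x then reg s x + k else reg s y) (pos s) (out s).

Lemma iter_perform_reg a r k s : ~~ touches a r ->
  reg (iter k (perform a) s) r = reg s r.
Proof.
move=> ha; elim: k => //= k <-; case: a ha => //= x /negbTE xr;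
  by rewrite /set_reg eq_sym xr.
Qed.

Lemma iter_perform_comm a a' r k s :
  (a' = Inc r \/ a' = Dec r) -> ~~ touches a r ->
  perform a' (iter k (perform a) s) = iter k (perform a) (perform a' s).
Proof.
move=> ha' ha; elim: k => //= k <-; move: (iter _ _ _) => {}s.
case: ha' => ->; case: a ha => //= x /negbTE xr; apply: storeE => //= y;
  rewrite /set_reg /= ?xr 1?(eq_sym r x) ?xr;
  by case: (y =P x) => // ->; rewrite xr.
Qed.

(** Reading a register means counting it down. Its value is rebuilt in [x], so that a second
    transfer can restore it. *)
Definition transfer r x a :=
  While (NonZero r) (Seq (Do (Dec r)) (Seq (Do (Inc x)) (Do a))).

Lemma runs_transfer w r x a s : r != x -> ~~ touches a r -> ~~ touches a x ->
  runs w (transfer r x a) s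
    (iter (reg s r) (perform a) (shift r x (reg s r) s)) (reg s r * 4 + 1).
Proof.
move=> rx ar ax; set k := reg s r.
have {1}-> : s = iter 0 (perform a) (shift r x 0 s).
  apply: storeE => //= y; rewrite subn0 addn0.
  by case: eqP => [->|_] //; case: eqP => [->|].
apply: (runs_loop (S := fun i => iter i (perform a) (shift r x i s))).
  by move=> i ik; rewrite iter_perform_reg //= eqxx.
move=> i ik.
have -> : iter i.+1 (perform a) (shift r x i.+1 s) =
    perform a (perform (Inc x) (perform (Dec r) (iter i (perform a) (shift r x i s)))).
  rewrite (iter_perform_comm (r := r)) //; last by right.
  rewrite (iter_perform_comm (r := x)) //; last by left.
  rewrite /=; congr perform; congr iter; apply: storeE => //= y.
  rewrite /set_reg /= (eq_sym x r) (negbTE rx) !eqxx.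
  case: (y =P x) => [->|_]; last by case: eqP => // _; lia.
  by rewrite eq_sym (negbTE rx); lia.
apply: runs_seq (runs_do _ _ _) (runs_do _ _ _).
Qed.

Lemma iter_inc d k s : iter k (perform (Inc d)) s =
  Store (set_reg (reg s) d (reg s d + k)) (pos s) (out s).
Proof.
elim: k => [|k /= ->] /=; apply: storeE => //= y; rewrite /set_reg /= ?addn0.
  by case: eqP => [->|].
by rewrite eqxx; case: eqP; lia.
Qed.

Lemma iter_put b k s : iter k (perform (Put b)) s =
  Store (reg s) (pos s) (out s ++ nseq k b).
Proof.
elim: k => [|k /= ->]; first by rewrite cats0; case: s.
by rewrite /= -cats1 -catA cats1; congr (Store _ _ (_ ++ _)); elim: k => //= k ->.
Qed.

Lemma iter_inr k s : iter k (perform InR) s = Store (reg s) (pos s + k) (out s).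
Proof.
elim: k => [|k /= ->]; first by rewrite addn0; case: s.
by rewrite /= addnS.
Qed.

Lemma iter_inl k s : iter k (perform InL) s = Store (reg s) (pos s - k) (out s).
Proof.
elim: k => [|k /= ->]; first by rewrite subn0; case: s.
by rewrite /= subnS.
Qed.

Fixpoint repeat_act k a := if k is k'.+1 then Seq (Do a) (repeat_act k' a) else Do Nop.

Lemma runs_repeat_act w k a s : runs w (repeat_act k a) s (iter k (perform a) s) k.+1.
Proof.
elim: k s => [|k IH] s; first exact: runs_do.
rewrite iterSr -add1n; exact: runs_seq (runs_do _ _ _) (IH _).
Qed.

Definition clear r := While (NonZero r) (Do (Dec r)).

Lemma runs_clear w r s :
  runs w (clear r) s (Store (set_reg (reg s) r 0) (pos s) (out s)) (reg s r * 2 + 1).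
Proof.
set k := reg s r.
pose S i := Store (set_reg (reg s) r (k - i)) (pos s) (out s).
have {1}-> : s = S 0.
  by apply: storeE => //= y; rewrite /set_reg subn0; case: eqP => [->|].
have -> : set_reg (reg s) r 0 = set_reg (reg s) r (k - k) by rewrite subnn.
apply: (runs_while (S := S)) => [i ik||i ik] /=; rewrite /set_reg ?eqxx; try lia.
have -> : S i.+1 = perform (Dec r) (S i); last exact: runs_do.
by apply: storeE => //= y; rewrite /set_reg eqxx; case: eqP => //; lia.
Qed.

(** * Generators of number lists *)

(* Variables are de Bruijn indices; [GOut c vs] produces the number
   [c + \sum_(v <- vs) v], and [GIf v] tests bit [v] of the input word. *)
Inductive gen :=
| GNil
| GOut of nat & seq nat
| GCat of gen & gen
| GFor of nat & gen
| GIf of nat & gen & gen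
| GLet of nat & seq nat & gen
| GMul of nat & nat & gen.

Definition lin (env : seq nat) (c : nat) (vs : seq nat) : nat :=
  c + sumn [seq nth 0 env v | v <- vs].

Fixpoint den (w : seq bool) (env : seq nat) (g : gen) : seq nat :=
  match g with
  | GNil => [::]
  | GOut c vs => [:: lin env c vs]
  | GCat g1 g2 => den w env g1 ++ den w env g2
  | GFor v g1 => flatten [seq den w (i :: env) g1 | i <- iota 0 (nth 0 env v)]
  | GIf v g1 g2 => if nth false w (nth 0 env v) then den w env g1 else den w env g2
  | GLet c vs g1 => den w (lin env c vs :: env) g1
  | GMul v1 v2 g1 => den w (nth 0 env v1 * nth 0 env v2 :: env) g1
  end.

(* [rho] lists the registers of the variables; those from [d] on are free. *)
Definition copy (rho : seq nat) v tmp a :=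
  if v < size rho then
    Seq (transfer (nth 0 rho v) tmp Nop) (transfer tmp (nth 0 rho v) a)
  else Do Nop.

Definition copies rho vs tmp a :=
  foldr (fun v c => Seq (copy rho v tmp a) c) (Do Nop) vs.

(** Moving the input head consumes the variable; the value saved in [tmp] lets [rewind] bring the
    head back and restore the variable. *)
Definition seek (rho : seq nat) v tmp :=
  if v < size rho then transfer (nth 0 rho v) tmp InR else Do Nop.

Definition rewind (rho : seq nat) v tmp :=
  if v < size rho then transfer tmp (nth 0 rho v) InL else Do Nop.

(** In a loop, [d] holds the index, [d.+1] the number of rounds left, and [d.+2] is scratch for
    copying, which the body may reuse. In a product, [d] accumulates the result. Every construct
    resets its registers to 0, as the next one expects. The branches of [GIf] both rewind, the bit
    read being remembered by the program counter. *)
Fixpoint compile (rho : seq nat) (d : nat) (g : gen) : cmd :=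
  match g with
  | GNil => Do Nop
  | GOut c vs =>
      Seq (repeat_act c (Put true))
        (Seq (copies rho vs d (Put true)) (Do (Put false)))
  | GCat g1 g2 => Seq (compile rho d g1) (compile rho d g2)
  | GFor v g1 =>
      Seq (copy rho v d.+2 (Inc d.+1))
        (Seq (While (NonZero d.+1)
                (Seq (Do (Dec d.+1)) (Seq (compile (d :: rho) d.+2 g1) (Do (Inc d)))))
           (clear d))
  | GIf v g1 g2 =>
      Seq (seek rho v d)
        (If InBit (Seq (rewind rho v d) (compile rho d g1))
           (Seq (rewind rho v d) (compile rho d g2)))
  | GLet c vs g1 =>
      Seq (repeat_act c (Inc d))
        (Seq (copies rho vs d.+1 (Inc d)) (Seq (compile (d :: rho) d.+1 g1) (clear d)))
  | GMul v1 v2 g1 =>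
      Seq (copy rho v1 d.+2 (Inc d.+1))
        (Seq (While (NonZero d.+1) (Seq (Do (Dec d.+1)) (copy rho v2 d.+2 (Inc d))))
           (Seq (compile (d :: rho) d.+1 g1) (clear d)))
  end.

Definition holds_env (rho : seq nat) (d : nat) (env : seq nat) (f : nat -> nat) :=
  size rho = size env /\
  forall v, v < size rho -> nth 0 rho v < d /\ f (nth 0 rho v) = nth 0 env v.

Lemma holds_env_ext rho d env f f' : holds_env rho d env f ->
  (forall r, r < d -> f' r = f r) -> holds_env rho d env f'.
Proof. by case=> e h h'; split=> // v /h [h1 h2]; rewrite h' // h2. Qed.

Lemma holds_env_cons rho d env f d' k : holds_env rho d env f -> f d = k -> d < d' ->
  holds_env (d :: rho) d' (k :: env) f.
Proof.
case=> e h fd dd; split; first by rewrite /= e.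
by case=> [|v] //= hv; have [h1 h2] := h v hv; split=> //; apply: ltn_trans dd.
Qed.

Lemma runs_copy w rho d env v tmp a s :
  holds_env rho d env (reg s) -> d <= tmp -> reg s tmp = 0 -> ~~ touches a tmp ->
  (forall r, r < d -> ~~ touches a r) ->
  runs w (copy rho v tmp a) s (iter (nth 0 env v) (perform a) s)
    (nth 0 env v * 8 + 2).
Proof.
case=> e h dt t0 at_ ad; rewrite /copy; case: ltnP => hv; last first.
  rewrite nth_default -?e //; exact: runs_le (runs_do _ _ _) _.
have [rd rv] := h v hv; set r := nth 0 rho v in rd rv *; set k := nth 0 env v.
have rt : r != tmp by lia.
have := runs_transfer w (a := Nop) s rt isT isT; rewrite rv -/k.
have nop n z : iter n (perform Nop) z = z by elim: n.
rewrite nop.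
set s1 := shift _ _ _ _ => h1.
have k1 : reg s1 tmp = k by rewrite /= eq_sym (negbTE rt) eqxx t0.
have := runs_transfer w (a := a) (r := tmp) (x := r) s1.
rewrite eq_sym rt k1 => /(_ isT at_ (ad _ rd)).
have -> : shift tmp r k s1 = s.
  apply: storeE => //= y; rewrite !eqxx (eq_sym tmp r) (negbTE rt) t0 rv -/k.
  case: eqP => [->|_]; first by rewrite t0; lia.
  by case: eqP => // ->; rewrite rv -/k; lia.
by move=> h2; apply: runs_le (runs_seq h1 h2) _; lia.
Qed.

Lemma iter_perform_far rho d env a k s : holds_env rho d env (reg s) ->
  (forall r, r < d -> ~~ touches a r) ->
  holds_env rho d env (reg (iter k (perform a) s)).
Proof.
by move=> h ha; apply: holds_env_ext h _ => r rd; rewrite iter_perform_reg // ha.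
Qed.

Lemma runs_copies w rho d env vs tmp a s :
  holds_env rho d env (reg s) -> d <= tmp -> reg s tmp = 0 -> ~~ touches a tmp ->
  (forall r, r < d -> ~~ touches a r) ->
  runs w (copies rho vs tmp a) s (iter (lin env 0 vs) (perform a) s)
    (lin env 0 vs * 8 + (size vs * 2).+1).
Proof.
move=> he dt; elim: vs s he => [|v vs IH] s he t0 at_ ad; first exact: runs_do.
have h1 := runs_copy w v he dt t0 at_ ad.
have /(_ (iter_perform_far _ he ad)) h2 := IH (iter (nth 0 env v) (perform a) s).
rewrite iter_perform_reg // in h2; have {}h2 := h2 t0 at_ ad.
rewrite -iterD addnC in h2.
have -> : lin env 0 (v :: vs) = nth 0 env v + lin env 0 vs by rewrite /lin /=; lia.
by apply: runs_le (runs_seq h1 h2) _; rewrite /=; lia.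
Qed.

(** x + y <= 2xy for positive x and y, and the base is at least 2; the base [b.+2] thus lets sums
    disappear into exponents. *)
Lemma addn_expn b c1 c2 : b.+2 ^ c1 + b.+2 ^ c2 <= b.+2 ^ (c1 + c2).+1.
Proof.
have h1 : 0 < b.+2 ^ c1 by rewrite expn_gt0.
have h2 : 0 < b.+2 ^ c2 by rewrite expn_gt0.
by rewrite expnS expnD; move: (_ ^ c1) (_ ^ c2) h1 h2 => x y; nia.
Qed.

Lemma leq_linear_expn b k m : m <= k * b.+2 -> m <= b.+2 ^ k.+1.
Proof.
move=> h; apply: leq_trans h _; rewrite expnSr leq_mul2r; apply/orP; right.
exact/ltnW/ltn_expl.
Qed.

Lemma lin_le env c vs b : (forall v, nth 0 env v <= b) ->
  lin env c vs <= c + size vs * b.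
Proof.
move=> h; rewrite /lin leq_add2l; elim: vs => //= v vs IH.
by rewrite mulSn; apply: leq_add.
Qed.

Lemma bits_of_nats_cat s1 s2 :
  bits_of_nats (s1 ++ s2) = bits_of_nats s1 ++ bits_of_nats s2.
Proof. by rewrite /bits_of_nats map_cat flatten_cat. Qed.

(** The exponent [e] depends on the generator alone; input, environment and output enter the time
    only through the bound [b] on the values of the variables. The position 0 is both required and
    restored. *)
Definition compile_spec g e := forall w rho d env s b,
  holds_env rho d env (reg s) -> (forall r, d <= r -> reg s r = 0) -> pos s = 0 ->
  (forall v, nth 0 env v <= b) ->
  runs w (compile rho d g) s
    (Store (reg s) 0 (out s ++ bits_of_nats (den w env g))) (b.+2 ^ e).

Lemma compile_out c vs : compile_spec (GOut c vs) (c + 3 + 10 * size vs).+1.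
Proof.
move=> w rho d env s b he h0 p0 hb /=.
have h1 := runs_repeat_act w c (Put true) s; rewrite iter_put in h1.
have h2 := runs_copies w vs (s := Store (reg s) (pos s) (out s ++ nseq c true))
  (a := Put true) he (leqnn d) (h0 _ (leqnn _)) isT (fun _ _ => isT).
rewrite iter_put /= in h2.
have h3 := runs_seq h1 (runs_seq h2 (runs_do w (Put false) _)).
have -> : Store (reg s) 0 (out s ++ bits_of_nats [:: lin env c vs]) =
  perform (Put false) (Store (reg s) (pos s) ((out s ++ nseq c true) ++ nseq (lin env 0 vs) true)).
  rewrite /= p0 /bits_of_nats /= cats0 -rcons_cat; congr (Store _ _ (rcons _ _)).
  by rewrite -catA /lin add0n nseqD.
apply: runs_le h3 _; apply: leq_linear_expn.
have := lin_le 0 vs hb; nia.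
Qed.

Lemma compile_cat g1 g2 e1 e2 : compile_spec g1 e1 -> compile_spec g2 e2 ->
  compile_spec (GCat g1 g2) (e1 + e2).+1.
Proof.
move=> IH1 IH2 w rho d env s b he h0 p0 hb /=.
have h1 := IH1 w _ _ _ _ _ he h0 p0 hb.
have h2 := IH2 w _ _ _ (Store (reg s) 0 (out s ++ bits_of_nats (den w env g1)))
  _ he h0 erefl hb.
rewrite /= -catA -bits_of_nats_cat in h2.
exact: runs_le (runs_seq h1 h2) (addn_expn _ _ _).
Qed.

Lemma compile_for v g e : compile_spec g e -> compile_spec (GFor v g) (e + 14).+1.
Proof.
move=> IH w rho d env s b he h0 p0 hb; set k := nth 0 env v.
have h1 := runs_copy w v he (a := Inc d.+1) (leq_trans (leqnSn _) (leqnSn _)).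
have {h1} := h1 (h0 _ (leq_trans (leqnSn _) (leqnSn _))).
rewrite /= -/k => /(_ _ _) h1.
have {h1} := h1 ltac:(by lia) ltac:(by move=> r; lia).
rewrite iter_inc h0 // add0n p0 => h1.
pose S i := Store (fun r => if r == d then i else if r == d.+1 then k - i else reg s r)
  0 (out s ++ bits_of_nats (flatten [seq den w (j :: env) g | j <- iota 0 i])).
have h2 : runs w (While (NonZero d.+1)
   (Seq (Do (Dec d.+1)) (Seq (compile (d :: rho) d.+2 g) (Do (Inc d)))))
   (S 0) (S k) (k * (b.+2 ^ e + 1).+2 + 1).
  apply: runs_loop => [i ik|i ik] /=; first by rewrite ifF ?eqxx //; lia.
  have := IH w (d :: rho) d.+2 (i :: env) (perform (Dec d.+1) (S i)) b.
  have he2 : holds_env (d :: rho) d.+2 (i :: env) (reg (perform (Dec d.+1) (S i))).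
    apply: holds_env_cons => //; last by rewrite /= /set_reg !eqxx ifF //; lia.
    apply: holds_env_ext he _ => r rd; rewrite /= /set_reg.
    by rewrite !ifF //; lia.
  move=> /(_ he2) h; have {h} := h _ erefl _.
  have -> : S i.+1 = perform (Inc d)
     (Store (reg (perform (Dec d.+1) (S i))) 0
       (out (perform (Dec d.+1) (S i)) ++ bits_of_nats (den w (i :: env) g))).
    have ei : iota 0 i.+1 = iota 0 i ++ [:: i] by rewrite -addn1 iotaD.
    apply: storeE => //.
      move=> r; rewrite /= /set_reg /= !eqxx.
      case: (r =P d) => [_|_]; first by rewrite ifF //; lia.
      by case: (r =P d.+1) => // _; rewrite ifF; lia.
    rewrite {1}/S {1}/out ei map_cat flatten_cat bits_of_nats_cat catA /=.
    by rewrite cats0.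
  move=> h; apply: runs_seq (runs_do _ _ _); apply: h.
    by move=> r rd /=; rewrite /set_reg !ifF ?h0 //; lia.
  by case=> [|u] //=; apply: leq_trans (ltnW ik) (hb v).
have e0 : Store (set_reg (reg s) d.+1 k) 0 (out s) = S 0.
  apply: storeE => //= [r|]; last by rewrite cats0.
  rewrite /set_reg subn0; case: (r =P d) => [->|_] //.
  by rewrite ifF ?h0 //; lia.
rewrite e0 in h1.
have h3 := runs_clear w d (S k); rewrite /= eqxx in h3.
have e1 : Store (set_reg (reg (S k)) d 0) 0 (out (S k)) =
  Store (reg s) 0 (out s ++ bits_of_nats (den w env (GFor v g))).
  apply: storeE => //= r; rewrite /set_reg subnn.
  case: (r =P d) => [->|_]; first by rewrite h0.
  by case: (r =P d.+1) => // ->; rewrite h0 //; lia.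
rewrite [Store (set_reg _ _ _) _ _]e1 in h3.
apply: runs_le (runs_seq h1 (runs_seq h2 h3)) _.
have kb : k <= b := hb v.
(* 13 = 8 + 3 + 2 is the cost per round of copying the loop bound, driving the loop and clearing the
   index. *)
have h14 : b.+2 ^ e + 13 <= b.+2 ^ (e + 14).
  rewrite (addnS e 13); apply: leq_trans (addn_expn b e 13); rewrite leq_add2l.
  exact/ltnW/ltn_expl.
rewrite expnS; apply: (@leq_trans (b.+2 * (b.+2 ^ e + 13))).
  by move: (_ ^ e) => x; nia.
by rewrite leq_mul2l h14 orbT.
Qed.

Lemma runs_seek w rho d env v s : holds_env rho d env (reg s) -> reg s d = 0 ->
  pos s = 0 ->
  exists s', [/\ runs w (seek rho v d) s s' (nth 0 env v * 4 + 1),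
    pos s' = nth 0 env v & runs w (rewind rho v d) s' s (nth 0 env v * 4 + 1)].
Proof.
case=> e h d0 p0; rewrite /seek /rewind; case: ltnP => hv; last first.
  exists s; rewrite nth_default -?e //.
  by split=> //; apply: runs_le (runs_do _ _ _) _.
have [rd rv] := h v hv; set r := nth 0 rho v in rd rv *; set k := nth 0 env v.
have rt : r != d by lia.
have := runs_transfer w (a := InR) s rt isT isT; rewrite rv -/k iter_inr.
set s1 := Store _ _ _ => h1; exists s1; split=> //; first by rewrite /= p0.
have := runs_transfer w (a := InL) (r := d) (x := r) s1.
have -> : reg s1 d = k by rewrite /= eqxx d0 eq_sym (negbTE rt).
rewrite eq_sym rt iter_inl => /(_ isT isT isT).
set s2 := Store _ _ _; suff -> : s2 = s by [].
apply: storeE => //=; last by lia.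
move=> y; rewrite !eqxx rv -/k (eq_sym d) (negbTE rt) d0.
case: (y =P d) => [->|_]; first by rewrite d0; lia.
by case: (y =P r) => // ->; rewrite rv -/k; lia.
Qed.

Lemma compile_if v g1 g2 e1 e2 : compile_spec g1 e1 -> compile_spec g2 e2 ->
  compile_spec (GIf v g1 g2) (9 + (e1 + e2).+1).+1.
Proof.
move=> IH1 IH2 w rho d env s b he h0 p0 hb.
have [s' [h1 ps' h2]] := runs_seek w v he (h0 _ (leqnn _)) p0.
have kb := hb v.
have hadd := addn_expn b e1 e2.
have hadd2 := addn_expn b 9 (e1 + e2).+1.
have h8 : 8 * b.+2 <= b.+2 ^ 9 by apply: (leq_linear_expn (k := 8)).
rewrite /=; case E: (nth false w _).
- have h3 := IH1 w _ _ _ _ _ he h0 p0 hb.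
  have h4 := @runs_if w InBit (Seq (rewind rho v d) (compile rho d g1))
    (Seq (rewind rho v d) (compile rho d g2)) s'.
  rewrite /= ps' E in h4; have {}h4 := h4 _ _ (runs_seq h2 h3).
  by apply: runs_le (runs_seq h1 h4) _; lia.
- have h3 := IH2 w _ _ _ _ _ he h0 p0 hb.
  have h4 := @runs_if w InBit (Seq (rewind rho v d) (compile rho d g1))
    (Seq (rewind rho v d) (compile rho d g2)) s'.
  rewrite /= ps' E in h4; have {}h4 := h4 _ _ (runs_seq h2 h3).
  by apply: runs_le (runs_seq h1 h4) _; lia.
Qed.

(** The common tail of [GLet] and [GMul], which differ in how register [d] obtains its value. *)
Lemma compile_scope g e rho d env s b x : compile_spec g e ->
  holds_env rho d env (reg s) -> (forall r, d <= r -> reg s r = 0) -> pos s = 0 ->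
  (forall v, nth 0 env v <= b) -> x <= b ->
  forall w, runs w (Seq (compile (d :: rho) d.+1 g) (clear d))
    (Store (set_reg (reg s) d x) 0 (out s))
    (Store (reg s) 0 (out s ++ bits_of_nats (den w (x :: env) g)))
    (b.+2 ^ e + (x * 2 + 1)).
Proof.
move=> IH he h0 p0 hb xb w.
set s1 := Store (set_reg _ _ _) _ _.
have he1 : holds_env (d :: rho) d.+1 (x :: env) (reg s1).
  apply: holds_env_cons => //; last by rewrite /= /set_reg eqxx.
  by apply: holds_env_ext he _ => r rd; rewrite /= /set_reg ifF //; lia.
have h1 := IH w _ _ _ s1 b he1.
have {h1} := h1 _ erefl _; move=> h1.
have {}h1 := h1 ltac:(by move=> r rd; rewrite /= /set_reg ifF ?h0 //; lia)
  ltac:(by case).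
have h2 := runs_clear w d (Store (reg s1) 0 (out s1 ++ bits_of_nats (den w (x :: env) g))).
rewrite /= set_reg_eq in h2.
have -> : reg s = set_reg (set_reg (reg s) d x) d 0.
  apply: functional_extensionality => r; rewrite /set_reg.
  by case: (r =P d) => // ->; rewrite h0.
exact: runs_seq h1 h2.
Qed.

Lemma compile_let c vs g e : compile_spec g e ->
  compile_spec (GLet c vs g) ((c + size vs + 2).+1 * e + (3 * c + 10 * size vs + 4).+1).+1.
Proof.
move=> IH w rho d env s b he h0 p0 hb; rewrite /compile -/compile.
have h1 := runs_repeat_act w c (Inc d) s; rewrite iter_inc h0 // add0n p0 in h1.
have he1 : holds_env rho d env (reg (Store (set_reg (reg s) d c) 0 (out s))).
  by apply: holds_env_ext he _ => r rd; rewrite /= /set_reg ifF //; lia.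
have := runs_copies w vs (a := Inc d) he1 (leqnSn d).
have -> : reg (Store (set_reg (reg s) d c) 0 (out s)) d.+1 = 0.
  by rewrite /= /set_reg ifF ?h0 //; lia.
move=> /(_ erefl) h2.
have {h2} := h2 ltac:(by rewrite /=; lia) ltac:(by move=> r rd; rewrite /=; lia).
have llin : c + lin env 0 vs = lin env c vs by [].
rewrite iter_inc /= set_reg_eq llin.
have -> : set_reg (set_reg (reg s) d c) d (lin env c vs) = set_reg (reg s) d (lin env c vs).
  by apply: functional_extensionality => r; rewrite /set_reg; case: (r =P d).
move=> h2.
have hl := lin_le c vs hb.
(* The new variable may exceed [b], so the body runs under a larger bound; this is at most a fixed
   power of [b.+2], which multiplies the exponent [e]. *)
have h3 := compile_scope (b := c + size vs * b + b) (x := lin env c vs) IH he h0 p0.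
have {}h3 := h3 ltac:(by move=> v; apply: leq_trans (hb v) (leq_addl _ _))
  ltac:(by apply: leq_trans hl (leq_addr _ _)) w.
apply: runs_le (runs_seq h1 (runs_seq h2 h3)) _.
apply: leq_trans (addn_expn _ _ _).
have hX : (c + size vs * b + b).+2 <= b.+2 ^ (c + size vs + 2).+1.
  by apply: leq_linear_expn; nia.
have hT : (c + size vs * b + b).+2 ^ e <= b.+2 ^ ((c + size vs + 2).+1 * e).
  by rewrite expnM; case: (e) => // e'; rewrite leq_exp2r.
have hK : 3 * c + 10 * (size vs * b) + 2 * size vs + 4
    <= b.+2 ^ (3 * c + 10 * size vs + 4).+1 by apply: leq_linear_expn; nia.
move: hT hK hl; rewrite -llin; move: (_ ^ _) (_ ^ _) (_ ^ _) => x y z.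
by lia.
Qed.

Lemma compile_mul v1 v2 g e : compile_spec g e ->
  compile_spec (GMul v1 v2 g) (2 * e + 6).+1.
Proof.
move=> IH w rho d env s b he h0 p0 hb; rewrite /compile -/compile.
set k1 := nth 0 env v1; set k2 := nth 0 env v2.
have h1 := runs_copy w v1 he (a := Inc d.+1) (leq_trans (leqnSn _) (leqnSn _)).
have {}h1 := h1 (h0 _ (leq_trans (leqnSn _) (leqnSn _))).
have {h1} := h1 ltac:(by rewrite /=; lia) ltac:(by move=> r; rewrite /=; lia).
rewrite -/k1 iter_inc h0 // add0n p0 => h1.
pose S i := Store (fun r => if r == d then i * k2 else if r == d.+1 then k1 - i
  else reg s r) 0 (out s).
have h2 : runs w (While (NonZero d.+1)
   (Seq (Do (Dec d.+1)) (copy rho v2 d.+2 (Inc d)))) (S 0) (S k1)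
   (k1 * (k2 * 8 + 2).+2 + 1).
  apply: runs_loop => [i ik|i ik] /=; first by rewrite ifF ?eqxx //; lia.
  have he2 : holds_env rho d env (reg (perform (Dec d.+1) (S i))).
    apply: holds_env_ext he _ => r rd; rewrite /= /set_reg.
    by rewrite !ifF //; lia.
  have h := runs_copy w v2 he2 (a := Inc d) (leq_trans (leqnSn _) (leqnSn _)).
  have {}h := h ltac:(by rewrite /= /set_reg !ifF ?h0 //; lia).
  have {h} := h ltac:(by rewrite /=; lia) ltac:(by move=> r; rewrite /=; lia).
  suff -> : iter (nth 0 env v2) (perform (Inc d)) (perform (Dec d.+1) (S i)) = S i.+1 by [].
  rewrite iter_inc; apply: storeE => //= r; rewrite /set_reg /= !eqxx.
  case: (r =P d) => [_|_]; first by rewrite ifF -/k2; lia.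
  by case: (r =P d.+1) => // _; rewrite ifF; lia.
have e0 : Store (set_reg (reg s) d.+1 k1) 0 (out s) = S 0.
  apply: storeE => //= r; rewrite /set_reg subn0 mul0n.
  case: (r =P d) => [->|_] //; by rewrite ifF ?h0 //; lia.
have e1 : S k1 = Store (set_reg (reg s) d (k1 * k2)) 0 (out s).
  apply: storeE => //= r; rewrite /set_reg subnn.
  by case: (r =P d) => // _; case: (r =P d.+1) => // ->; rewrite h0.
rewrite e0 in h1; rewrite e1 in h2.
have kb1 : k1 <= b := hb v1; have kb2 : k2 <= b := hb v2.
(* The product may reach [b * b]; the larger bound is below the square of [b.+2] and doubles the
   exponent. *)
have h3 := compile_scope (b := b * b + b) (x := k1 * k2) IH he h0 p0.
have {}h3 := h3 ltac:(by move=> v; apply: leq_trans (hb v) (leq_addl _ _))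
  ltac:(by apply: leq_trans (leq_mul kb1 kb2) (leq_addr _ _)) w.
apply: runs_le (runs_seq h1 (runs_seq h2 h3)) _.
apply: leq_trans (addn_expn _ _ _).
have hX : (b * b + b).+2 <= b.+2 ^ 2 by rewrite -mulnn; nia.
have hT : (b * b + b).+2 ^ e <= b.+2 ^ (2 * e).
  by rewrite expnM; case: (e) => // e'; rewrite leq_exp2r.
have h4 : 16 <= b.+2 ^ 4.
  by rewrite -[16]/(2 ^ 4) leq_exp2r.
have hK : 16 * (b.+2 * b.+2) <= b.+2 ^ 6.
  by rewrite (expnD _ 4 2) -mulnn; apply: leq_mul.
have hk : k1 * k2 <= b * b by apply: leq_mul.
move: hT hK; move: (_ ^ _) (_ ^ _) (_ ^ _) => x y z.
by nia.
Qed.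

Lemma runs_compile g : exists e, compile_spec g e.
Proof.
elim: g => [|c vs|g1 [e1 h1] g2 [e2 h2]|v g [e h]|v g1 [e1 h1] g2 [e2 h2]
  |c vs g [e h]|v1 v2 g [e h]].
- exists 0 => w rho d env [f p o] b _ _ /= -> _; rewrite cats0.
  exact: runs_do.
- by eexists; apply: compile_out.
- by eexists; apply: compile_cat h1 h2.
- by eexists; apply: compile_for h.
- by eexists; apply: compile_if h1 h2.
- by eexists; apply: compile_let h.
- by eexists; apply: compile_mul h.
Qed.

(** The two transfers bring the head back to cell 0 and leave the count in register 0. *)
Definition read_length :=
  Seq (While NonBlank (Seq (Do InR) (Do (Inc 0))))
    (Seq (transfer 0 1 InL) (transfer 1 0 Nop)).

Lemma runs_read_length w :
  runs w read_length (Store (fun=> 0) 0 [::])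
    (Store (fun r => if r == 0 then size w else 0) 0 [::]) (13 * (size w).+2).
Proof.
set n := size w.
pose S i := Store (fun r => if r == 0 then i else 0) i [::].
have h1 : runs w (While NonBlank (Seq (Do InR) (Do (Inc 0)))) (S 0) (S n) (n * 3 + 1).
  apply: runs_while => [i ik||i ik] //=; first by rewrite -leqNgt.
  have -> : S i.+1 = perform (Inc 0) (perform InR (S i)).
    by apply: storeE => //= r; rewrite /set_reg; case: eqP.
  exact: runs_seq (runs_do _ _ _) (runs_do _ _ _).
have e0 : S 0 = Store (fun=> 0) 0 [::] by apply: storeE => //= r; case: eqP.
rewrite e0 in h1.
have h2 := runs_transfer w (r := 0) (x := 1) (a := InL) (S n) isT isT isT.
rewrite iter_inl /= in h2.
set s2 := Store _ _ _ in h2.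
have h3 := runs_transfer w (r := 1) (x := 0) (a := Nop) s2 isT isT isT.
have nop m z : iter m (perform Nop) z = z by elim: m.
rewrite nop [reg s2 1]/= add0n in h3.
have e3 : shift 1 0 n s2 = Store (fun r => if r == 0 then n else 0) 0 [::].
  by apply: storeE => [[|[|r]]||] //=; lia.
rewrite e3 in h3.
by apply: runs_le (runs_seq h1 (runs_seq h2 h3)) _; lia.
Qed.

(** From here on no machine has to be considered: it suffices to write the serialised instance as a
    generator in the single variable [size w]. *)
Theorem gen_polytime g : polytime (fun w => bits_of_nats (den w [:: size w] g)).
Proof.
have [e h] := runs_compile g.
apply: (cmd_polytime (c := Seq read_length (compile [:: 0] 1 g)) (k := (14 + e).+1)) => w.
have h1 := runs_read_length w.
set s1 := Store (fun r => if _ then _ else _) _ _ in h1.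
have he : holds_env [:: 0] 1 [:: size w] (reg s1) by split=> // -[].
have h2 := h w _ _ _ s1 (size w) he.
have z1 r : 1 <= r -> reg s1 r = 0 by case: r.
have b1 v : nth 0 [:: size w] v <= size w by case: v => [|[|v]].
have {}h2 := h2 z1 erefl b1.
have [t tT ev] := runs_seq h1 h2.
eexists; exists t; split; [|exact: ev|by []].
apply: leq_trans tT _; apply: leq_trans (addn_expn _ _ _); rewrite leq_add2r.
exact: leq_linear_expn.
Qed.

(** * Binary decision diagrams *)

Section TrueBdd.
Context {d : Order.disp_t} {W : finOrderType d}.

Let lab : {ffun 'I_1 -> @bdd_node d W 1} := [ffun=> inl true].

Lemma true_bdd_ok : [&& bdd_ordered lab, bdd_reduced lab
  & [forall i, connect (bdd_edge lab) ord0 i]].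
Proof.
apply/and3P; split.
- by apply/forallP => i; rewrite ffunE.
- apply/andP; split; first by apply/forallP => i; rewrite ffunE.
  by apply/injectiveP => i j _; rewrite (ord1 i) (ord1 j).
- by apply/forallP => i; rewrite (ord1 i) connect0.
Qed.

(** The state law of the reduction: all valuations are states. *)
Definition true_bdd : bdd W := Bdd true_bdd_ok.

Lemma true_bddE v : bdd_fun true_bdd v.
Proof. by rewrite /bdd_fun ffunE. Qed.

Lemma true_bdd_code vc : bdd_code vc true_bdd = [:: 1; 0; 1].
Proof. by rewrite /bdd_code /= enum_ordSl enum_ord0 /= ffunE. Qed.

End TrueBdd.

(* Nodes [3k], [3k+1], [3k+2] test the k-th pair p, p' of the range; node
   [3 len] is the terminal true and [3 len + 1] the terminal false. *)
Section RangeBdd.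
Variables (n lo len : nat).
Hypotheses (len_gt0 : 0 < len) (range_le : lo + len <= n.+1).

Let W := primed 'I_n.+1.
Let var (k : nat) (b : bool) : W := (inord (lo + k), b).

Definition range_node (i : nat) : @bdd_node _ W (3 * len).+2 :=
  if i < 3 * len then
    match i %% 3 with
    | 0 => inr (var (i %/ 3) false, inord i.+1, inord i.+2)
    | 1 => inr (var (i %/ 3) true, inord i.+2, inord (3 * len).+1)
    | _ => inr (var (i %/ 3) true, inord (3 * len).+1, inord i.+1)
    end
  else inl (i == 3 * len).

Definition range_lab := [ffun i : 'I_(3 * len).+2 => range_node i].

(** Case analysis by the number [k] of the pair, which leaves linear arithmetic instead of quotients
    and remainders. *)
Variant range_spec (i : nat) : @bdd_node _ W (3 * len).+2 -> Type :=
| RangeFst k of k < len & i = 3 * k :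
    range_spec i (inr (var k false, inord (3 * k + 1), inord (3 * k + 2)))
| RangeLo k of k < len & i = 3 * k + 1 :
    range_spec i (inr (var k true, inord (3 * k + 3), inord (3 * len).+1))
| RangeHi k of k < len & i = 3 * k + 2 :
    range_spec i (inr (var k true, inord (3 * len).+1, inord (3 * k + 3)))
| RangeTrue of i = 3 * len : range_spec i (inl true)
| RangeFalse of i = (3 * len).+1 : range_spec i (inl false).

Lemma range_nodeP i : i < (3 * len).+2 -> range_spec i (range_node i).
Proof.
move=> hi; rewrite /range_node; case: ltnP => h; last first.
  by case: eqP => e; constructor; lia.
have e := divn_eq i 3; have := ltn_mod i 3; set k := i %/ 3 in e *.
have hk : k < len by lia.
case: (i %% 3) e => [|[|[|]]] // e _.
- have -> : i.+2 = 3 * k + 2 by lia.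
  by have -> : i.+1 = 3 * k + 1; [lia|constructor=> //; lia].
- by have -> : i.+2 = 3 * k + 3; [lia|constructor=> //; lia].
- by have -> : i.+1 = 3 * k + 3; [lia|constructor=> //; lia].
Qed.

Lemma range_labP (i : 'I_(3 * len).+2) : range_spec i (range_lab i).
Proof. by rewrite ffunE; apply: range_nodeP. Qed.

Lemma var_lt k k' (b b' : bool) : k < k' < len \/ [/\ k = k', k < len, ~~ b & b'] ->
  (var k b < var k' b')%O.
Proof.
move=> h.
have [hk hk'] : k < len /\ k' < len by case: h => [|[]]; lia.
rewrite Order.ProdLexiOrder.ltEprodlexi !Order.OrdinalOrder.leEord /=.
rewrite !inordK; [|lia|lia].
case: h => [h|[-> _ /negbTE -> ->]]; last by rewrite leqnn.
by apply/andP; split; [lia|apply/implyP; lia].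
Qed.

(** The third hypothesis concerns a child in the same pair: it tests p', so its parent has to test
    p, the smaller of the two. *)
Lemma range_below k b m : 3 * k < m -> m < (3 * len).+2 ->
  (m <= 3 * k + 2 -> ~~ b) -> k < len ->
  bdd_below range_lab (var k b) (inord m).
Proof.
move=> h1 h2 h3 hk; rewrite /bdd_below.
case: range_labP => // k' hk'; rewrite inordK // => e; apply: var_lt.
- by left; lia.
- by case: (ltngtP k k') => h; [left|lia|right; split=> //; apply: h3; lia]; lia.
- by case: (ltngtP k k') => h; [left|lia|right; split=> //; apply: h3; lia]; lia.
Qed.

Lemma range_ok : [&& bdd_ordered range_lab, bdd_reduced range_lab
  & [forall i, connect (bdd_edge range_lab) ord0 i]].
Proof.
apply/and3P; split.
- apply/forallP => i; case: range_labP => // k hk _; apply/andP;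
    by split; apply: range_below => //; lia.
- apply/andP; split.
    apply/forallP => i; case: range_labP => // k hk _;
      by apply/eqP => /(congr1 (@nat_of_ord _)); rewrite !inordK; lia.
  have inj (x x' : W) (a b a' b' : 'I_(3 * len).+2) :
      inr (x, a, b) = inr (x', a', b') :> @bdd_node _ W (3 * len).+2 ->
      [/\ x.2 = x'.2, a = a' :> nat & b = b' :> nat] by case=> -> -> ->.
  apply/injectiveP => i j; move: (range_labP i) (range_labP j).
  case=> [k hk ei|k hk ei|k hk ei|ei|ei];
    case=> [k' hk' ej|k' hk' ej|k' hk' ej|ej|ej] //; first [
      by move=> _; apply: val_inj; rewrite /= ei ej
    | move=> /inj [] //= _; rewrite !inordK; try lia;
      by move=> *; apply: val_inj => /=; lia ].
- have edge i j : bdd_edge range_lab i j -> connect (bdd_edge range_lab) ord0 i ->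
      connect (bdd_edge range_lab) ord0 j.
    by move=> e h; apply: connect_trans h (connect1 e).
  have lab m : m < (3 * len).+2 -> range_lab (inord m) = range_node m.
    by move=> hm; rewrite ffunE inordK.
  have fst k : k <= len -> connect (bdd_edge range_lab) ord0 (inord (3 * k)) /\
     (k < len -> connect (bdd_edge range_lab) ord0 (inord (3 * k + 1)) /\
     connect (bdd_edge range_lab) ord0 (inord (3 * k + 2))).
    have child k' : k' < len -> connect (bdd_edge range_lab) ord0 (inord (3 * k')) ->
     connect (bdd_edge range_lab) ord0 (inord (3 * k' + 1)) /\
     connect (bdd_edge range_lab) ord0 (inord (3 * k' + 2)).
      move=> hk h; split; apply: edge h; rewrite /bdd_edge lab; try lia;
        case: range_nodeP => [|k'' h e|k'' h e|k'' h e|e|e]; try lia;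
        by have -> : k' = k''; [lia|rewrite eqxx ?orbT].
    elim: k => [|k IH] hk.
      have h : connect (bdd_edge range_lab) ord0 (inord (3 * 0)).
        suff -> : inord (3 * 0) = ord0 :> 'I_(3 * len).+2 by exact: connect0.
        by apply: val_inj; rewrite /= inordK.
      by split=> // hl; apply: child.
    have [h1 /(_ hk) [h2 h3]] := IH (ltnW hk).
    suff h : connect (bdd_edge range_lab) ord0 (inord (3 * k.+1)).
      by split=> // hk1; apply: child.
    apply: edge h2; rewrite /bdd_edge lab; try lia.
    case: range_nodeP => [|k'' h e|k'' h e|k'' h e|e|e]; try lia.
    by have -> : 3 * k.+1 = 3 * k'' + 3; [lia|rewrite eqxx].
  apply/forallP => i; rewrite -[i]inord_val.
  case: (range_nodeP (ltn_ord i)) => [k hk ->|k hk ->|k hk ->|->|->].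
  - by have [] := fst k (ltnW hk).
  - by have [_ /(_ hk) []] := fst k (ltnW hk).
  - by have [_ /(_ hk) []] := fst k (ltnW hk).
  - by have [] := fst len (leqnn _).
  - have [_ /(_ len_gt0) [h _]] := fst 0 (leq0n _); apply: edge h.
    rewrite /bdd_edge lab; try lia.
    case: range_nodeP => [|k'' h e|k'' h e|k'' h e|e|e]; try lia.
    by rewrite eqxx orbT.
Qed.

Definition range_bdd : bdd W := Bdd range_ok.

(** The walk spends two steps on each pair and moves to the terminal false at the first
    disagreement; the steps left over stay at a terminal. *)
Lemma range_bddE (v : {set W}) :
  bdd_fun range_bdd v =
  all (fun k => (var k false \in v) == (var k true \in v)) (iota 0 len).
Proof.
pose eqv k := (var k false \in v) == (var k true \in v).
have lab m : m < (3 * len).+2 -> range_lab (inord m) = range_node m.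
  by move=> hm; rewrite ffunE inordK.
have wF : bdd_walk range_lab v (inord (3 * len).+1) = inord (3 * len).+1.
  by rewrite /bdd_walk lab //; case: range_nodeP => //; lia.
have wT : bdd_walk range_lab v (inord (3 * len)) = inord (3 * len).
  by rewrite /bdd_walk lab; [case: range_nodeP => //; lia|lia].
have w2 k : k < len ->
    bdd_walk range_lab v (bdd_walk range_lab v (inord (3 * k))) =
    inord (if eqv k then 3 * k.+1 else (3 * len).+1).
  move=> hk; rewrite {2}/bdd_walk lab; last by lia.
  case: range_nodeP => [|k1 h e|k1 h e|k1 h e|e|e]; try lia.
  have {e} <- : k = k1 by lia.
  rewrite /eqv; case: (var k false \in v); rewrite /bdd_walk lab; try lia;
    case: range_nodeP => [|k2 h2 e|k2 h2 e|k2 h2 e|e|e]; try lia;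
    have <- : k = k2 by lia.
  + by case: (var k true \in v) => //=; congr inord; lia.
  + by case: (var k true \in v) => //=; congr inord; lia.
have wk k : k <= len -> iter (k * 2) (bdd_walk range_lab v) ord0 =
    inord (if all eqv (iota 0 k) then 3 * k else (3 * len).+1).
  elim: k => [|k IH] hk; first by apply: val_inj; rewrite /= inordK.
  have -> : iota 0 k.+1 = rcons (iota 0 k) k by rewrite -addn1 iotaD cats1.
  rewrite all_rcons [k.+1 * 2]mulSn !iterS IH; last exact: ltnW.
  case: (all _ _); last by rewrite andbF !wF.
  by rewrite andbT w2.
have card : #|{: W}| = n.+1 * 2 by rewrite card_prod card_ord card_bool.
rewrite /bdd_fun /bdd_end /= card -(subnK (_ : len * 2 <= n.+1 * 2)); last by lia.
rewrite iterD wk // -/eqv.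
have wfix i m : bdd_walk range_lab v i = i -> iter m (bdd_walk range_lab v) i = i.
  by move=> e; elim: m => //= m ->.
case: (all _ _); rewrite wfix //; rewrite ffunE inordK; try lia.
- by case: range_nodeP => //; lia.
- by case: range_nodeP => //; lia.
Qed.

Lemma range_bdd_pair (s t : {set 'I_n.+1}) :
  bdd_fun range_bdd (pair_val s t) <->
  forall p, lo <= p < lo + len -> (inord p \in s) = (inord p \in t).
Proof.
have inF (p : 'I_n.+1) b :
    (((p, b) : W) \in pair_val s t) = if b then p \in t else p \in s.
  rewrite /pair_val inE.
  have im c (u : {set 'I_n.+1}) : (((p, b) : W) \in [set ((q, c) : W) | q in u]) =
      (b == c) && (p \in u).
    apply/imsetP/andP => [[q qu [-> ->]]|[/eqP -> pu]]; first by rewrite eqxx.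
    by exists p.
  by rewrite !im {im}; case: b => //=; rewrite ?orbF.
rewrite range_bddE; split=> [/allP h p hp|h].
  have := h (p - lo); rewrite mem_iota => /(_ ltac:(by lia)) /eqP.
  by rewrite !inF subnKC //; lia.
by apply/allP => k; rewrite mem_iota => hk; rewrite !inF h //; lia.
Qed.

Lemma range_bdd_code :
  bdd_code (@primed_code n.+1) range_bdd =
  [:: (3 * len).+2, 0 &
    flatten [seq [:: 2; 2 * (lo + k); 3 * k + 1; 3 * k + 2;
                  2; (2 * (lo + k)).+1; 3 * k + 3; (3 * len).+1;
                  2; (2 * (lo + k)).+1; (3 * len).+1; 3 * k + 3]
            | k <- iota 0 len] ++ [:: 1; 0]].
Proof.
rewrite /bdd_code /=; congr [:: _, _ & _].
have -> : [seq node_code (@primed_code n.+1) (range_lab i) | i <- enum 'I_(3 * len).+2]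
    = [seq node_code (@primed_code n.+1) (range_node i) | i <- iota 0 (3 * len).+2].
  rewrite -val_enum_ord -map_comp; apply: eq_map => i /=; by rewrite ffunE.
have -> : iota 0 (3 * len).+2 = iota 0 (3 * len) ++ [:: 3 * len; (3 * len).+1].
  by rewrite -[in LHS]addn2 iotaD add0n.
rewrite map_cat flatten_cat; congr cat; last first.
  rewrite /=.
  case: range_nodeP => [|k hk|k hk|k hk|_|]; try lia.
  by case: range_nodeP => [|k hk|k hk|k hk||_]; try lia.
have pc k b : k < len -> primed_code (var k b) = 2 * (lo + k) + b.
  by move=> hk; rewrite /primed_code /= inordK; lia.
suff gen m : m <= len ->
   flatten [seq node_code (@primed_code n.+1) (range_node i) | i <- iota 0 (3 * m)] =
   flatten [seq [:: 2; 2 * (lo + k); 3 * k + 1; 3 * k + 2;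
                  2; (2 * (lo + k)).+1; 3 * k + 3; (3 * len).+1;
                  2; (2 * (lo + k)).+1; (3 * len).+1; 3 * k + 3]
            | k <- iota 0 m] by apply: gen.
elim: m => [|m IH] hm //.
have -> : 3 * m.+1 = 3 * m + 3 by lia.
rewrite iotaD map_cat flatten_cat IH; last exact: ltnW.
have -> : iota 0 m.+1 = iota 0 m ++ [:: m] by rewrite -addn1 iotaD.
rewrite map_cat flatten_cat; congr cat.
rewrite add0n /=.
case: range_nodeP => [|k hk e|k hk e|k hk e|e|e]; try lia.
have <- : m = k by lia.
case: range_nodeP => [|k1 hk1 e1|k1 hk1 e1|k1 hk1 e1|e1|e1]; try lia.
have <- : m = k1 by lia.
case: range_nodeP => [|k2 hk2 e2|k2 hk2 e2|k2 hk2 e2|e2|e2]; try lia.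
have <- : m = k2 by lia.
rewrite /= !pc // !inordK; try lia.
by rewrite addn0; have -> : 2 * (lo + m) + true = (2 * (lo + m)).+1 by rewrite addn1.
Qed.

End RangeBdd.

(** * Boolean formula templates *)

(* Variables are those of [gen]: [TAtom c vs] is the atom with number
   [lin env c vs]. *)
Inductive tf :=
| TTop
| TAtom of nat & seq nat
| TNeg of tf
| TAnd of tf & tf
| TAll of nat & tf
| TIf of nat & tf & tf.

(** In prefix notation an iterated conjunction is a plain loop over the symbol 4 and a conjunct,
    closed by the code 0 of [Top]. *)
Fixpoint tgen (phi : tf) : gen :=
  match phi with
  | TTop => GOut 0 [::]
  | TAtom c vs => GCat (GOut 2 [::]) (GOut c vs)
  | TNeg a => GCat (GOut 3 [::]) (tgen a)
  | TAnd a b => GCat (GOut 4 [::]) (GCat (tgen a) (tgen b))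
  | TAll v a => GCat (GFor v (GCat (GOut 4 [::]) (tgen a))) (GOut 0 [::])
  | TIf v a b => GIf v (tgen a) (tgen b)
  end.

Fixpoint tbev (w : seq bool) (env : seq nat) (x : nat -> bool) (phi : tf) : bool :=
  match phi with
  | TTop => true
  | TAtom c vs => x (lin env c vs)
  | TNeg a => ~~ tbev w env x a
  | TAnd a b => tbev w env x a && tbev w env x b
  | TAll v a => all (fun i => tbev w (i :: env) x a) (iota 0 (nth 0 env v))
  | TIf v a b => if nth false w (nth 0 env v) then tbev w env x a
                 else tbev w env x b
  end.

(** For an atom out of range, [inord] in [tform] would give a default atom while [tgen] prints the
    original number; [tok] excludes this. *)
Fixpoint tok (n : nat) (w : seq bool) (env : seq nat) (phi : tf) : bool :=
  match phi with
  | TTop => true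
  | TAtom c vs => lin env c vs <= n
  | TNeg a => tok n w env a
  | TAnd a b => tok n w env a && tok n w env b
  | TAll v a => all (fun i => tok n w (i :: env) a) (iota 0 (nth 0 env v))
  | TIf v a b => if nth false w (nth 0 env v) then tok n w env a
                 else tok n w env b
  end.

Fixpoint tform m n (w : seq bool) (env : seq nat) (phi : tf) : EL 'I_m 'I_n.+1 :=
  match phi with
  | TTop => Top
  | TAtom c vs => Atom (inord (lin env c vs))
  | TNeg a => Neg (tform m n w env a)
  | TAnd a b => And (tform m n w env a) (tform m n w env b)
  | TAll v a => foldr (fun i => And (tform m n w (i :: env) a)) Top
                  (iota 0 (nth 0 env v))
  | TIf v a b => if nth false w (nth 0 env v) then tform m n w env a
                 else tform m n w env b
  end.

Lemma den_tgen m n w env phi : tok n w env phi ->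
  den w env (tgen phi) = EL_code (tform m n w env phi).
Proof.
elim: phi env => [|c vs|a IH|a IHa b IHb|v a IH|v a IHa b IHb] env /=.
- by [].
- by move=> h; rewrite inordK.
- by move/IH ->.
- by case/andP => /IHa -> /IHb ->.
- by elim: (iota _ _) => //= i l IHl /andP [/IH -> /IHl <-]; rewrite -catA.
- by case: nth => [/IHa|/IHb].
Qed.

Lemma sat_tform m n w env (F : belief_structure 'I_m 'I_n.+1) s phi :
  sat F s (tform m n w env phi) = tbev w env (fun p => inord p \in s) phi.
Proof.
elim: phi env => [|c vs|a IH|a IHa b IHb|v a IH|v a IHa b IHb] env //=.
- by rewrite IH.
- by rewrite IHa IHb.
- by elim: (iota _ _) => //= i l ->; rewrite IH.
- by case: nth.
Qed.

(** * Derived connectives *)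

Definition timp a b := TNeg (TAnd a (TNeg b)).
Definition tor a b := TNeg (TAnd (TNeg a) (TNeg b)).
Definition tiff a b := TAnd (timp a b) (timp b a).
Definition tite a b c := TAnd (timp a b) (tor a c).
Definition tex v a := TNeg (TAll v (TNeg a)).
Definition tlit (b : bool) a := if b then a else TNeg a.
Definition tconst b := tlit b TTop.
Definition tands := foldr TAnd TTop.
Definition tors l := TNeg (tands [seq TNeg a | a <- l]).

Section TemplateTheory.
Variables (w : seq bool) (env : seq nat) (x : nat -> bool) (n : nat).

Lemma tbev_neg a : tbev w env x (TNeg a) = ~~ tbev w env x a.
Proof. by []. Qed.

Lemma tbev_and a b : tbev w env x (TAnd a b) = tbev w env x a && tbev w env x b.
Proof. by []. Qed.

Lemma tbev_imp a b : tbev w env x (timp a b) = (tbev w env x a ==> tbev w env x b).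
Proof. by rewrite /= negb_and negbK implybE. Qed.

Lemma tbev_or a b : tbev w env x (tor a b) = tbev w env x a || tbev w env x b.
Proof. by rewrite /= negb_and !negbK. Qed.

Lemma tbev_iff a b : tbev w env x (tiff a b) = (tbev w env x a == tbev w env x b).
Proof. by rewrite /=; do 2!case: tbev. Qed.

Lemma tbev_ite a b c : tbev w env x (tite a b c) =
  if tbev w env x a then tbev w env x b else tbev w env x c.
Proof. by rewrite /=; do 3!case: tbev. Qed.

Lemma tbev_ex v a : tbev w env x (tex v a) =
  has (fun i => tbev w (i :: env) x a) (iota 0 (nth 0 env v)).
Proof. by rewrite /= -has_predC; apply: eq_has => i /=; rewrite negbK. Qed.

Lemma tbev_lit b a : tbev w env x (tlit b a) = (tbev w env x a == b).
Proof. by case: b => /=; case: tbev. Qed.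

Lemma tbev_const b : tbev w env x (tconst b) = b.
Proof. by case: b. Qed.

Lemma tbev_ands T (F : T -> tf) l :
  tbev w env x (tands [seq F i | i <- l]) = all (fun i => tbev w env x (F i)) l.
Proof. by elim: l => //= a l ->. Qed.

Lemma tbev_ors T (F : T -> tf) l :
  tbev w env x (tors [seq F i | i <- l]) = has (fun i => tbev w env x (F i)) l.
Proof.
by rewrite /= -map_comp tbev_ands; elim: l => //= a l IH; rewrite negb_and negbK IH.
Qed.

Lemma tok_and a b : tok n w env (TAnd a b) = tok n w env a && tok n w env b.
Proof. by []. Qed.

Lemma tok_imp a b : tok n w env (timp a b) = tok n w env a && tok n w env b.
Proof. by []. Qed.

Lemma tok_or a b : tok n w env (tor a b) = tok n w env a && tok n w env b.
Proof. by []. Qed.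

Lemma tok_neg a : tok n w env (TNeg a) = tok n w env a.
Proof. by []. Qed.

Lemma tok_ex v a : tok n w env (tex v a) = tok n w env (TAll v a).
Proof. by []. Qed.

Lemma tok_iff a b : tok n w env (tiff a b) = tok n w env a && tok n w env b.
Proof. by rewrite /=; case: (tok n w env a); case: (tok n w env b). Qed.

Lemma tok_ite a b c : tok n w env (tite a b c) =
  [&& tok n w env a, tok n w env b & tok n w env c].
Proof. by rewrite /=; do 3!case: tok. Qed.

Lemma tok_lit b a : tok n w env (tlit b a) = tok n w env a.
Proof. by case: b. Qed.

Lemma tok_const b : tok n w env (tconst b).
Proof. by case: b. Qed.

Lemma tok_ands T (F : T -> tf) l :
  tok n w env (tands [seq F i | i <- l]) = all (fun i => tok n w env (F i)) l.
Proof. by elim: l => //= a l ->. Qed.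

Lemma tok_ors T (F : T -> tf) l :
  tok n w env (tors [seq F i | i <- l]) = all (fun i => tok n w env (F i)) l.
Proof. by rewrite /= -map_comp tok_ands. Qed.

End TemplateTheory.

Lemma all_iotaP (a : pred nat) k : reflect (forall i, i < k -> a i) (all a (iota 0 k)).
Proof.
apply: (iffP allP) => [h i ik|h i]; first by apply: h; rewrite mem_iota.
by rewrite mem_iota => /andP [_]; apply: h.
Qed.

Lemma all_enumP (T : finType) (a : pred T) : reflect (forall i, a i) (all a (enum T)).
Proof.
apply: (iffP allP) => [h i|h i _]; last exact: h.
by apply: h; rewrite mem_enum.
Qed.

(** Repeating a variable is how a linear term obtains a constant coefficient. *)
Lemma lin_nseq_cat env k m v vs :
  lin env k (nseq m v ++ vs) = k + m * nth 0 env v + lin env 0 vs.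
Proof. by rewrite /lin map_cat map_nseq sumn_cat sumn_nseq mulnC addnA. Qed.

(** * The reduction *)

Section Reduction.
Variables (M : tm) (c : nat).

Let Tape : finType := 'I_(tm_tapes M).+1.
Let Sym : finType := option (bool + tm_aux M).

(* The bits of a configuration at a position: the symbol on a tape, the presence
   of a head, and the control state (repeated at every position). *)
Definition feat : finType := (Tape * Sym + Tape + tm_state M)%type.
Definition fsym (j : Tape) (a : Sym) : feat := inl (inl (j, a)).
Definition fhead (j : Tape) : feat := inl (inr j).
Definition fstate (q : tm_state M) : feat := inr q.

Definition cfbit (cf : tm_config M) (f : feat) (i : nat) : bool :=
  match f with
  | inl (inl (j, a)) => (cf_tape cf j i : Sym) == a
  | inl (inr j) => cf_head cf j == i
  | inr q => cf_state cf == q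
  end.

Definition rk (f : feat) : nat := enum_rank f.
Definition nfeat := #|feat|.

Variables (w : seq bool).
Let n := size w.
(** The space bound limits the heads, which need not visit the whole input. The summand n makes the
    input fit, and the 2 makes [P.-1] and [P.-2] true differences. *)
Definition space := (n + (c * n ^ c + c)).+2.
Let P := space.
Definition width := nfeat * P.
Let B := width.

Lemma rk_lt f : rk f < nfeat.
Proof. exact: ltn_ord. Qed.

Lemma width_gt0 : 0 < B.
Proof. by rewrite muln_gt0 andbT; apply: leq_ltn_trans (rk_lt (fstate (tm_start M))). Qed.

Lemma rk_width f i : i < P -> rk f * P + i < B.
Proof. by have := rk_lt f; rewrite /B /width => h1 h2; nia. Qed.

(** Bit [rk f * P + i] is feature [f] at position [i]. Cells from [P] on are forgotten, so [enc]
    need not be injective. *)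
Definition enc (cf : tm_config M) : seq bool :=
  mkseq (fun k => cfbit cf (nth (fstate (tm_start M)) (enum feat) (k %/ P)) (k %% P)) B.

Lemma encP (x : nat -> bool) cf :
  (forall f i, i < P -> x (rk f * P + i) = cfbit cf f i) <-> mkseq x B = enc cf.
Proof.
split=> [h|h f i iP].
  apply: (@eq_from_nth _ false); rewrite ?size_mkseq // => k kB.
  rewrite !nth_mkseq // -h ?ltn_mod //.
  have kK : k %/ P < nfeat by rewrite ltn_divLR.
  rewrite -(enum_val_nth (fstate (tm_start M)) (Ordinal kK)) /rk enum_valK /=.
  by rewrite -divn_eq.
rewrite -(nth_mkseq false x (rk_width f iP)) h nth_mkseq ?rk_width //.
by rewrite divnMDl // divn_small // addn0 modnMDl modn_small // /rk nth_enum_rank.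
Qed.

(* The templates below refer to these entries by position, shifted by one inside
   a [TAll]: 3 is B, 4 is P, 5 is P - 1, 6 is P - 2, 7 is P - n, 8 is n. *)
Definition benv (z : seq nat) : seq nat :=
  [:: (5 * B).+1, 3 * B, 2 * B, B, P, P.-1, P.-2, P - n, n & z].

(** Block [t] starts at [t * B = t * nfeat * P], so the coefficient of P is a constant of the
    machine. [at1] is the form under one [TAll], where P has index 5 and the bound position has
    index 0. *)
Definition at0 t f k := TAtom k (nseq (t * nfeat + rk f) 4).
Definition at1 t f k vs := TAtom k (nseq (t * nfeat + rk f) 5 ++ vs).

Lemma lin_at0 z t f k : lin (benv z) k (nseq (t * nfeat + rk f) 4) = t * B + (rk f * P + k).
Proof.
rewrite -[nseq _ _]cats0 lin_nseq_cat [nth _ _ _]/= /lin /= /B /width; lia.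
Qed.

Lemma lin_at1 z t f k i vs :
  lin (i :: benv z) k (nseq (t * nfeat + rk f) 5 ++ vs) =
  t * B + (rk f * P + (k + lin (i :: benv z) 0 vs)).
Proof. by rewrite lin_nseq_cat [nth _ _ _]/= /B /width; lia. Qed.

Lemma lin_loop z i : lin (i :: benv z) 0 [:: 0] = i.
Proof. by rewrite /lin /=; lia. Qed.

Lemma lin_last z f :
  lin (benv z) 0 (nseq (1 * nfeat + rk f) 4 ++ [:: 5]) = B + (rk f * P + P.-1).
Proof.
have e4 : nth 0 (benv z) 4 = P by [].
have e5 : lin (benv z) 0 [:: 5] = P.-1 by apply: addn0.
by rewrite lin_nseq_cat e4 e5 /B /width; lia.
Qed.

Lemma tbev_at0 z x t f k :
  tbev w (benv z) x (at0 t f k) = x (t * B + (rk f * P + k)).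
Proof. by rewrite /= lin_at0. Qed.

Lemma tbev_at1 z x t f k i :
  tbev w (i :: benv z) x (at1 t f k [:: 0]) = x (t * B + (rk f * P + (k + i))).
Proof. by rewrite [LHS]/= lin_at1 lin_loop. Qed.

(** * Formulas for a step, the start and acceptance *)

Definition delta_ext (q : tm_state M) (g : {ffun Tape -> Sym}) :
    tm_state M * (Tape -> Sym * move) :=
  if tm_halt q is Some _ then (q, fun j => (g j, Stay)) else tm_delta q g.

Definition reads (cf : tm_config M) : {ffun Tape -> Sym} :=
  [ffun j => cf_tape cf j (cf_head cf j)].

(** Halting is folded into the transition table: a halting state persists and writes back what it
    reads. *)
Lemma tm_stepE cf : let d := delta_ext (cf_state cf) (reads cf) in
  [/\ cf_state (tm_step cf) = d.1,
      forall j, cf_head (tm_step cf) j = move_head (d.2 j).2 (cf_head cf j)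
    & forall j i, cf_tape (tm_step cf) j i =
        if i == cf_head cf j then (d.2 j).1 else cf_tape cf j i].
Proof.
rewrite /delta_ext /tm_step; case: (tm_halt _) => [b|] /=.
  by split=> // j i; rewrite ffunE; case: eqP => [->|].
by rewrite -/(reads cf); case: (tm_delta _ _).
Qed.

Definition t_read j a :=
  tex 4 (TAnd (at1 0 (fhead j) 0 [:: 0]) (at1 0 (fsym j a) 0 [:: 0])).

Definition t_current q (g : {ffun Tape -> Sym}) :=
  TAnd (at0 0 (fstate q) 0) (tands [seq t_read j (g j) | j <- enum Tape]).

(** After [MoveL], the head is at cell 0 if it was at 0 or 1, at cell i + 1 if it was at i + 2, and
    never at the last cell. After [MoveR] it is never at cell 0. *)
Definition t_move f (m : move) :=
  match m with
  | Stay => TAll 4 (tiff (at1 1 f 0 [:: 0]) (at1 0 f 0 [:: 0]))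
  | MoveR => TAnd (TNeg (at0 1 f 0))
               (TAll 5 (tiff (at1 1 f 1 [:: 0]) (at1 0 f 0 [:: 0])))
  | MoveL =>
      TAnd (tiff (at0 1 f 0) (tor (at0 0 f 0) (at0 0 f 1)))
        (TAnd (TAll 6 (tiff (at1 1 f 1 [:: 0]) (at1 0 f 2 [:: 0])))
           (TNeg (TAtom 0 (nseq (1 * nfeat + rk f) 4 ++ [:: 5]))))
  end.

Definition t_update q (g : {ffun Tape -> Sym}) (f : feat) :=
  let: (q', act) := delta_ext q g in
  match f with
  | inl (inl (j, a)) =>
      TAll 4 (tiff (at1 1 f 0 [:: 0])
        (tite (at1 0 (fhead j) 0 [:: 0]) (tconst ((act j).1 == a))
           (at1 0 f 0 [:: 0])))
  | inl (inr j) => t_move f (act j).2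
  | inr q'' => TAll 4 (tlit (q' == q'') (at1 1 f 0 [:: 0]))
  end.

(** The conjunctions over states, scanned symbols and features are fixed by the machine; only
    positions are ranged over by loops. *)
Definition t_step :=
  tands [seq tands [seq timp (t_current q g) (tands [seq t_update q g f | f <- enum feat])
                   | g <- enum {ffun Tape -> Sym}]
        | q <- enum (tm_state M)].

Section StepSemantics.
Variables (z : seq nat) (x : nat -> bool) (cf : tm_config M).
Hypothesis hX : forall f i, i < P -> x (rk f * P + i) = cfbit cf f i.
Hypothesis headP : forall j, cf_head cf j < P.

Lemma tbev_current q g :
  tbev w (benv z) x (t_current q g) = (cf_state cf == q) && (reads cf == g).
Proof.
rewrite /t_current tbev_and tbev_at0 mul0n add0n hX //.
congr andb; rewrite tbev_ands.
apply/all_enumP/eqP => [h|<- j].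
  apply/ffunP => j; have := h j; rewrite tbev_ex => /hasP [i].
  rewrite mem_iota add0n => iP; rewrite tbev_and !tbev_at1 !mul0n !add0n !hX //=.
  by rewrite ffunE => /andP [/eqP -> /eqP].
rewrite tbev_ex; apply/hasP; exists (cf_head cf j).
  by rewrite mem_iota add0n; apply: headP.
by rewrite tbev_and !tbev_at1 !mul0n !add0n !hX ?headP //= ffunE !eqxx.
Qed.

Lemma tbev_update f :
  tbev w (benv z) x (t_update (cf_state cf) (reads cf) f) <->
  (forall i, i < P -> x (B + (rk f * P + i)) = cfbit (tm_step cf) f i).
Proof.
have [] := tm_stepE cf; rewrite /t_update.
case: (delta_ext _ _) => q' act /= hq hh ht.
have allP v a : reflect (forall i, i < nth 0 (benv z) v -> tbev w (i :: benv z) x a)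
   (tbev w (benv z) x (TAll v a)) by exact: all_iotaP.
have P2 : 1 < P by [].
have one : 1 * B = B by rewrite mul1n.
have zero : 0 * B = 0 by [].
case: f => [[[j a]|j]|q''].
- split=> [/allP h i iP|h].
    have := h i iP; rewrite tbev_iff tbev_ite tbev_const !tbev_at1 one zero !add0n.
    by rewrite !hX //= ht (eq_sym i) => /eqP ->; case: (cf_head cf j == i).
  apply/allP => i iP.
  rewrite tbev_iff tbev_ite tbev_const !tbev_at1 one zero !add0n.
  by rewrite !hX // h //= ht (eq_sym i); case: (cf_head cf j == i).
- move: (hh j); case: (act j).2 => {}hh; rewrite /= in hh; rewrite /t_move.
  + split.
      rewrite tbev_and tbev_iff tbev_or !tbev_at0 one zero !add0n !hX //.
      rewrite tbev_and; case/and3P => /eqP h0 /allP h1.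
      rewrite tbev_neg [tbev _ _ _ _]/= lin_last => h2.
      case=> [|i] iP; first by rewrite h0 /= hh; case: (cf_head _ _) => [|[|]].
      case: (ltnP i P.-2) => hi.
        have := h1 i hi; rewrite tbev_iff !tbev_at1 one zero !add0n hX; last by lia.
        by rewrite /= hh add1n add2n => /eqP ->; case: (cf_head _ _).
      (* The last cell: a head that was below [P] is not at [P.-1] after a left move. *)
      have -> : i = P.-2 by lia.
      rewrite [cfbit _ _ _]/= hh; have -> : P.-2.+1 = P.-1 by lia.
      rewrite (negbTE h2); have := headP j; case: (cf_head _ _) => [|k] // hk /=.
      by case: (k =P P.-1) => // e; lia.
    move=> h; rewrite tbev_and tbev_iff tbev_and; apply/and3P; split.
    - rewrite tbev_or !tbev_at0 one zero !add0n !hX // h //= hh.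
      by case: (cf_head _ _) => [|[|]].
    - apply/allP => i iP; rewrite tbev_iff !tbev_at1 one zero !add0n.
      have {}iP : i < P.-2 by [].
      rewrite hX; last by lia.
      rewrite h; last by lia.
      by rewrite /= hh add1n add2n; case: (cf_head _ _).
    rewrite tbev_neg [tbev _ _ _ _]/= lin_last.
    rewrite h; last by lia.
    rewrite [cfbit _ _ _]/= hh; have := headP j; case: (cf_head _ _) => [|k] // hk /=.
    by case: (k =P P.-1) => // e; lia.
  + split.
      rewrite tbev_and tbev_neg tbev_at0 one => /andP [/negbTE h0].
      move=> /allP h1 [|i] iP; first by rewrite h0 /= hh.
      have {}iP : i < P.-1 by [].
      have := h1 i iP; rewrite tbev_iff !tbev_at1 one zero !add0n hX; last by lia.
      by rewrite /= hh add1n => /eqP ->.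
    move=> h; rewrite tbev_and; apply/andP; split.
      by rewrite tbev_neg tbev_at0 one h //= hh.
    apply/allP => i iP; rewrite tbev_iff !tbev_at1 one zero !add0n.
    have {}iP : i < P.-1 by [].
    rewrite hX; last by lia.
    rewrite h; last by lia.
    by rewrite /= hh add1n.
  + split=> [/allP h i iP|h].
      have := h i iP; rewrite tbev_iff !tbev_at1 one zero !add0n hX //.
      by rewrite /= hh => /eqP ->.
    apply/allP => i iP; rewrite tbev_iff !tbev_at1 one zero !add0n hX // h //.
    by rewrite /= hh.
- split=> [/allP h i iP|h].
    by have := h i iP; rewrite tbev_lit tbev_at1 one add0n => /eqP -> /=; rewrite hq.
  by apply/allP => i iP; rewrite tbev_lit tbev_at1 one add0n h //= hq.
Qed.

Lemma tbev_step :
  tbev w (benv z) x t_step <->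
  (forall f i, i < P -> x (B + (rk f * P + i)) = cfbit (tm_step cf) f i).
Proof.
rewrite /t_step tbev_ands; split.
  move/all_enumP/(_ (cf_state cf)); rewrite tbev_ands.
  move/all_enumP/(_ (reads cf)); rewrite tbev_imp tbev_current !eqxx.
  by rewrite tbev_ands => /all_enumP h f; apply/tbev_update/h.
move=> h; apply/all_enumP => q; rewrite tbev_ands.
apply/all_enumP => g; rewrite tbev_imp tbev_current.
apply/implyP => /andP [/eqP <- /eqP <-]; rewrite tbev_ands.
by apply/all_enumP => f; apply/tbev_update/h.
Qed.

End StepSemantics.
(** The input tape follows the input bits below n and is blank on the remaining [P - n] cells; index
    9 is n seen under one binder. *)
Definition t_init (f : feat) :=
  match f with
  | inl (inl (j, a)) =>
      if j == ord0 then
        TAnd (TAll 8 (TIf 0 (tlit (a == Some (inl true)) (at1 0 f 0 [:: 0]))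
                        (tlit (a == Some (inl false)) (at1 0 f 0 [:: 0]))))
          (TAll 7 (tlit (a == None) (at1 0 f 0 [:: 0; 9])))
      else TAll 4 (tlit (a == None) (at1 0 f 0 [:: 0]))
  | inl (inr _) => TAnd (at0 0 f 0) (TAll 5 (TNeg (at1 0 f 1 [:: 0])))
  | inr q => TAll 4 (tlit (q == tm_start M) (at1 0 f 0 [:: 0]))
  end.

Definition t_inits := tands [seq t_init f | f <- enum feat].

Definition t_accept :=
  tors [seq at0 1 (fstate q) 0 | q <- enum (tm_state M) & tm_halt q == Some true].

(** [v] is the index of B: 3 at top level, 4 inside the loop that prints the levels of [reach]. *)
Definition t_eq v t t' :=
  TAll v (tiff (TAtom 0 (0 :: nseq t v.+1)) (TAtom 0 (0 :: nseq t' v.+1))).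

Lemma tbev_allP z x v a :
  reflect (forall i, i < nth 0 (benv z) v -> tbev w (i :: benv z) x a)
   (tbev w (benv z) x (TAll v a)).
Proof. exact: all_iotaP. Qed.

Lemma lin_shifted z i : lin (i :: benv z) 0 [:: 0; 9] = n + i.
Proof. by rewrite /lin /=; lia. Qed.

Lemma tbev_init z x f :
  tbev w (benv z) x (t_init f) <->
  (forall i, i < P -> x (rk f * P + i) = cfbit (tm_init M w) f i).
Proof.
have P2 : 1 < P by [].
have nP : n < P by rewrite /P /space; lia.
case: f => [[[j a]|j]|q]; rewrite /t_init.
- have bit i : cfbit (tm_init M w) (inl (inl (j, a))) i =
      ((if j == ord0 then tape_of_word M w i else None) == a).
    by rewrite /=; case: (j == ord0).
  case: (j =P ord0) bit => _ bit; last first.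
    split=> [/tbev_allP h i iP|h].
      have := h i iP; rewrite tbev_lit tbev_at1 mul0n !add0n => /eqP ->.
      by rewrite bit eq_sym.
    by apply/tbev_allP => i iP; rewrite tbev_lit tbev_at1 mul0n !add0n h // bit (eq_sym a).
  rewrite tbev_and; split=> [/andP [/tbev_allP h1 /tbev_allP h2] i iP|h].
    rewrite bit tape_of_wordE; case: ltnP => hi.
      have := h1 i hi; rewrite [tbev _ _ _ (TIf _ _ _)]/=.
      by case: (nth false w i); rewrite tbev_lit tbev_at1 mul0n !add0n => /eqP ->;
        rewrite eq_sym.
    have hi' : i - n < P - n by lia.
    have := h2 (i - n) hi'; rewrite tbev_lit [tbev _ _ _ _]/= lin_at1 lin_shifted.
    by rewrite mul0n !add0n subnKC // => /eqP ->; rewrite eq_sym.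
  apply/andP; split; apply/tbev_allP => i iP.
    have {}iP : i < n by [].
    have := h i (ltn_trans iP nP); rewrite bit tape_of_wordE iP [tbev _ _ _ (TIf _ _ _)]/=.
    by case: (nth false w i); rewrite tbev_lit tbev_at1 mul0n !add0n => ->;
      rewrite (eq_sym a).
  have {}iP : i < P - n by [].
  rewrite tbev_lit [tbev _ _ _ _]/= lin_at1 lin_shifted mul0n !add0n h; last by lia.
  by rewrite bit tape_of_wordE ltnNge leq_addr /= (eq_sym a).
- rewrite tbev_and tbev_at0 mul0n add0n; split.
    move=> /andP [h0 /tbev_allP h1] [|i] iP; first by rewrite h0.
    have {}iP : i < P.-1 by [].
    by have := h1 i iP; rewrite tbev_neg tbev_at1 mul0n add0n add1n => /negbTE ->.
  move=> h; apply/andP; split; first by rewrite h.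
  apply/tbev_allP => i iP; have {}iP : i < P.-1 by [].
  by rewrite tbev_neg tbev_at1 mul0n add0n add1n h //; lia.
- split=> [/tbev_allP h i iP|h].
    by have := h i iP; rewrite tbev_lit tbev_at1 mul0n !add0n => /eqP ->; rewrite eq_sym.
  by apply/tbev_allP => i iP; rewrite tbev_lit tbev_at1 mul0n !add0n h // (eq_sym q).
Qed.

Lemma tbev_inits z x :
  tbev w (benv z) x t_inits <-> mkseq x B = enc (tm_init M w).
Proof.
rewrite -encP tbev_ands; split=> [/all_enumP h f|h]; first exact/tbev_init/h.
by apply/all_enumP => f; apply/tbev_init/h.
Qed.

Lemma lin_block env v t i :
  lin (i :: env) 0 (0 :: nseq t v.+1) = t * nth 0 env v + i.
Proof. by rewrite /lin /= map_nseq sumn_nseq /=; lia. Qed.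

Lemma tform_eq m k env env' v v' t t' : nth 0 env v = nth 0 env' v' ->
  tform m k w env (t_eq v t t') = tform m k w env' (t_eq v' t t').
Proof.
by rewrite /= => e; rewrite -e; elim: (iota _ _) => //= i l ->; rewrite !lin_block e.
Qed.

Lemma tbev_eq z x t t' :
  tbev w (benv z) x (t_eq 3 t t') <->
  mkseq (fun k => x (t * B + k)) B = mkseq (fun k => x (t' * B + k)) B.
Proof.
split=> [/tbev_allP h|h].
  apply: (@eq_from_nth _ false); rewrite ?size_mkseq // => k kB; rewrite !nth_mkseq //.
  by have := h k kB; rewrite tbev_iff => /eqP; rewrite /= !lin_block.
apply/tbev_allP => k kB; have {}kB : k < B by [].
rewrite tbev_iff /= !lin_block /=.
by have := congr1 (fun l => nth false l k) h; rewrite !nth_mkseq // => ->.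
Qed.

Lemma tbev_accept z x cf :
  mkseq (fun k => x (B + k)) B = enc cf ->
  tbev w (benv z) x t_accept = (tm_halt (cf_state cf) == Some true).
Proof.
move=> /encP h; rewrite tbev_ors.
have bit q : tbev w (benv z) x (at0 1 (fstate q) 0) = (cf_state cf == q).
  by rewrite tbev_at0 mul1n h.
apply/hasP/idP => [[q]|hq].
  by rewrite mem_filter bit => /andP [hq _] /eqP ->.
by exists (cf_state cf); [rewrite mem_filter hq mem_enum|rewrite bit].
Qed.

(** * Ranges of the atoms *)

Section Bounds.
Variable z : seq nat.

Lemma tok_at0 t f k : t < 5 -> k < P -> tok (5 * B) w (benv z) (at0 t f k).
Proof. by move=> ht /(rk_width f) hk; rewrite [tok _ _ _ _]/= lin_at0; nia. Qed.

Lemma tok_at1 t f k i : t < 5 -> k + i < P ->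
  tok (5 * B) w (i :: benv z) (at1 t f k [:: 0]).
Proof.
by move=> ht /(rk_width f) hk; rewrite [tok _ _ _ _]/= lin_at1 lin_loop; nia.
Qed.

Lemma tok_allP v a :
  (forall i, i < nth 0 (benv z) v -> tok (5 * B) w (i :: benv z) a) ->
  tok (5 * B) w (benv z) (TAll v a).
Proof. by move=> h; apply/all_iotaP. Qed.

Lemma tok_eq env v t t' : nth 0 env v = B -> t < 5 -> t' < 5 ->
  tok (5 * B) w env (t_eq v t t').
Proof.
move=> e ht ht'; apply/all_iotaP => i; rewrite e => iB.
suff h u : u < 5 -> tok (5 * B) w (i :: env) (TAtom 0 (0 :: nseq u v.+1)).
  suff: tok (5 * B) w (i :: env)
    (tiff (TAtom 0 (0 :: nseq t v.+1)) (TAtom 0 (0 :: nseq t' v.+1))) by [].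
  by rewrite tok_iff !h.
by rewrite [tok _ _ _ _]/= lin_block e; nia.
Qed.

Lemma tok_accept : tok (5 * B) w (benv z) t_accept.
Proof. by rewrite tok_ors; apply/allP => q _; apply: tok_at0. Qed.

Lemma tok_inits : tok (5 * B) w (benv z) t_inits.
Proof.
have nP : n < P by rewrite /P /space; lia.
rewrite tok_ands; apply/all_enumP => -[[[j a]|j]|q]; rewrite /t_init.
- case: eqP => _; last by apply: tok_allP => i iP; rewrite tok_lit tok_at1.
  rewrite tok_and; apply/andP; split; apply: tok_allP => i iP.
    have {}iP : i < n by [].
    by rewrite [tok _ _ _ _]/=; case: nth; rewrite tok_lit tok_at1 //; lia.
  have {}iP : i < P - n by [].
  rewrite tok_lit [tok _ _ _ _]/= lin_at1 lin_shifted.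
  have : n + i < P by lia.
  move/(rk_width (inl (inl (j, a)))); rewrite mul0n !add0n => h.
  by apply: leq_trans (ltnW h) _; rewrite leq_pmull.
- rewrite tok_and tok_at0 //; apply: tok_allP => i iP; by rewrite tok_neg tok_at1.
- by apply: tok_allP => i iP; rewrite tok_lit tok_at1.
Qed.

Lemma tok_step : tok (5 * B) w (benv z) t_step.
Proof.
have P2 : 1 < P by [].
rewrite tok_ands; apply/all_enumP => q; rewrite tok_ands; apply/all_enumP => g.
rewrite tok_imp; apply/andP; split.
  rewrite tok_and tok_at0 // tok_ands; apply/all_enumP => j.
  by rewrite tok_ex; apply: tok_allP => i iP; rewrite tok_and !tok_at1.
rewrite tok_ands; apply/all_enumP => f; rewrite /t_update.
case: (delta_ext q g) => q' act.
case: f => [[[j a]|j]|q''].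
- by apply: tok_allP => i iP; rewrite tok_iff tok_ite tok_const !tok_at1.
- rewrite /t_move; case: (act j).2.
  + rewrite tok_and tok_iff tok_or !tok_at0 // !andTb tok_and; apply/andP; split.
      apply: tok_allP => i iP; have {}iP : i < P.-2 by [].
      by rewrite tok_iff !tok_at1 //; lia.
    rewrite tok_neg [tok _ _ _ _]/= lin_last.
    have : P.-1 < P by [].
    move/(rk_width (inl (inr j))) => h.
    by rewrite (mulnDl 1 4) mul1n leq_add2l; apply: leq_trans (ltnW h) _; rewrite leq_pmull.
  + rewrite tok_and tok_neg tok_at0 //.
    apply: tok_allP => i iP; have {}iP : i < P.-1 by [].
    by rewrite tok_iff !tok_at1 //; lia.
  + by apply: tok_allP => i iP; rewrite tok_iff !tok_at1.
- by apply: tok_allP => i iP; rewrite tok_lit tok_at1.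
Qed.

End Bounds.

(** * Halting within 2^B steps *)

Lemma nth_enc cf f i : i < P -> nth false (enc cf) (rk f * P + i) = cfbit cf f i.
Proof.
by apply: (encP (nth false (enc cf)) cf).2; rewrite -[RHS](mkseq_nth false) size_mkseq.
Qed.

Lemma eq_enc cf cf' :
  (forall f i, i < P -> cfbit cf f i = cfbit cf' f i) -> enc cf = enc cf'.
Proof. by move=> h; apply: eq_mkseq => k; apply: h; rewrite ltn_mod. Qed.

Lemma enc_state cf cf' : enc cf = enc cf' -> cf_state cf = cf_state cf'.
Proof.
move=> e; have := nth_enc cf' (fstate (cf_state cf)) (ltn0Sn _).
by rewrite -e nth_enc //= eqxx => /esym/eqP.
Qed.

(** Although [enc] forgets cells, it determines the next encoding: the step formula holds of
    [enc cf] followed by [enc (tm_step cf)], and it sees the first configuration only through its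
    bits, which [cf'] shares. *)
Lemma enc_step cf cf' :
  (forall j, cf_head cf j < P) -> (forall j, cf_head cf' j < P) ->
  enc cf = enc cf' -> enc (tm_step cf) = enc (tm_step cf').
Proof.
move=> h h' e.
pose x k := nth false (enc cf ++ enc (tm_step cf)) k.
have sz : size (enc cf) = B by rewrite size_mkseq.
have x0 f i : i < P -> x (rk f * P + i) = nth false (enc cf) (rk f * P + i).
  by move=> iP; rewrite /x nth_cat sz rk_width.
have x1 f i : i < P -> x (B + (rk f * P + i)) = cfbit (tm_step cf) f i.
  by move=> iP; rewrite /x nth_cat sz ltnNge leq_addr addKn nth_enc.
have ev : tbev w (benv [::]) x t_step.
  by apply: (tbev_step _ _ h).2 => // f i iP; rewrite x0 // nth_enc.
have x0' f i : i < P -> x (rk f * P + i) = cfbit cf' f i.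
  by move=> iP; rewrite x0 // e nth_enc.
apply: eq_enc => f i iP; rewrite -x1 //.
exact: (tbev_step [::] x0' h').1.
Qed.

Lemma tm_run_halted t d b : tm_halt (cf_state (tm_run M w t)) = Some b ->
  tm_run M w (t + d) = tm_run M w t.
Proof.
move=> h; elim: d => [|d IH]; first by rewrite addn0.
by rewrite addnS /tm_run iterS -/(tm_run M w _) IH /tm_step h.
Qed.

(** A machine still running after 2^B steps has repeated an encoding by the pigeonhole principle,
    and then its encodings cycle among those of non-halting configurations. A halted machine keeps
    its verdict. *)
Lemma halts_early t b :
  (forall t j, cf_head (tm_run M w t) j < P) ->
  tm_halt (cf_state (tm_run M w t)) = Some b ->
  tm_halt (cf_state (tm_run M w (2 ^ B))) = Some b.
Proof.
move=> hP ht.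
case E: (tm_halt (cf_state (tm_run M w (2 ^ B)))) => [b'|].
  case: (leqP t (2 ^ B)) => h.
    by rewrite -E -(subnKC h) (tm_run_halted _ ht).
  by rewrite -E -ht -(subnKC (ltnW h)) (tm_run_halted _ E).
have live u : u <= 2 ^ B -> tm_halt (cf_state (tm_run M w u)) = None.
  move=> hu; case Eu: (tm_halt _) => [b'|] //.
  by move: E; rewrite -(subnKC hu) (tm_run_halted _ Eu) Eu.
have sz u : size (enc (tm_run M w u)) == B by rewrite size_mkseq.
pose e (u : 'I_(2 ^ B).+1) : B.-tuple bool := Tuple (sz u).
have [u [v [uv euv]]] : exists u v, u < v <= 2 ^ B /\
    enc (tm_run M w u) = enc (tm_run M w v).
  case: (boolP (injectiveb e)) => [/injectiveP/leq_card|/injectivePn [u [v uv]]].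
    by rewrite card_ord card_tuple card_bool ltnn.
  move=> /(congr1 val) /= euv.
  have [h|h|h] := ltngtP u v; last by rewrite (val_inj h) eqxx in uv.
    by exists u, v; rewrite h -ltnS ltn_ord.
  by exists v, u; rewrite h -ltnS ltn_ord.
have shift d : enc (tm_run M w (u + d)) = enc (tm_run M w (v + d)).
  elim: d => [|d IH]; first by rewrite !addn0.
  by rewrite !addnS; apply: enc_step.
suff : tm_halt (cf_state (tm_run M w t)) = None by rewrite ht.
elim/ltn_ind: t {ht} => t IH; case: (leqP t v) => htv.
  by apply: live; lia.
(* Past time [v], the control state at [t] is the one at the earlier time [u + (t - v)]. *)
rewrite -(subnKC (ltnW htv)) -(enc_state (shift _)); apply: IH; lia.
Qed.

Definition natom := 5 * B.

(** Blocks 0 to 4 are X, Y, Z, U, V. The successor in the type of atoms is what [inord] asks for. *)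
Definition trk t (s : {set 'I_natom.+1}) : seq bool :=
  mkseq (fun k => (inord (t * B + k) : 'I_natom.+1) \in s) B.

(** Supplies the witness states of the modalities; a block given as [[::]] is false everywhere. *)
Definition of_tracks (l : seq (seq bool)) : {set 'I_natom.+1} :=
  [set p : 'I_natom.+1 | nth false (nth [::] l (p %/ B)) (p %% B)].

Lemma trk_of_tracks l t : t < 5 -> size (nth [::] l t) = B ->
  trk t (of_tracks l) = nth [::] l t.
Proof.
move=> t5 sz; apply: (@eq_from_nth _ false); rewrite size_mkseq // => k kB.
have h : t * B + k < natom.+1 by rewrite /natom; nia.
rewrite nth_mkseq // inE inordK // divnMDl ?width_gt0 // divn_small // addn0.
by rewrite modnMDl modn_small.
Qed.

Lemma size_trk t s : size (trk t s) = B.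
Proof. by rewrite size_mkseq. Qed.

Lemma agree_tracks a b (s t : {set 'I_natom.+1}) : a + b <= 5 ->
  (forall p, a * B <= p < a * B + b * B ->
     ((inord p : 'I_natom.+1) \in s) = (inord p \in t)) <->
  (forall u, a <= u < a + b -> trk u s = trk u t).
Proof.
move=> ab; split=> [h u hu|h p hp].
  apply: (@eq_from_nth _ false); rewrite !size_mkseq // => k kB.
  by rewrite !nth_mkseq //; apply: h; nia.
have B0 := width_gt0.
have hd := divn_eq p B; have hm := ltn_pmod p B0.
have hu : a <= p %/ B < a + b by apply/andP; split; nia.
have := congr1 (fun l => nth false l (p %% B)) (h _ hu).
by rewrite !nth_mkseq // -hd.
Qed.

(* Agent 0 keeps the blocks X, Y; agent 1 keeps X, Y, Z; agent 2 keeps U, V. *)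
Definition kept_lo (i : nat) := nth 0 [:: 0; 0; 3] i.
Definition kept_len (i : nat) := nth 2 [:: 2; 3; 2] i.

Lemma kept_len_gt0 i : 0 < kept_len i * B.
Proof. by have := width_gt0; case: i => [|[|[|[|]]]] //=; rewrite /kept_len /=; lia. Qed.

Lemma kept_le (i : 'I_3) : kept_lo i + kept_len i <= 5.
Proof. by case: i => [[|[|[|]]]]. Qed.

Lemma kept_range (i : 'I_3) : kept_lo i * B + kept_len i * B <= natom.+1.
Proof. by have := kept_le i; rewrite /natom; nia. Qed.

Definition obs_bdd (i : 'I_3) : bdd (primed 'I_natom.+1) :=
  range_bdd (kept_len_gt0 i) (kept_range i).

Definition red_instance (phi : EL 'I_3 'I_natom.+1) : mc_instance :=
  @McInstance 3 natom.+1 true_bdd [ffun i => obs_bdd i] set0 phi (true_bddE _).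

(** * Truth of the reachability formula *)

Section Formula.
Variable z : seq nat.
(** The structure does not depend on the formula of the instance; [Top] is a placeholder. *)
Let F := mc_structure (red_instance Top).

Lemma sat_know (i : 'I_3) s phi :
  sat F s (Know i phi) <->
  forall t, (forall u, kept_lo i <= u < kept_lo i + kept_len i -> trk u s = trk u t) ->
    sat F t phi.
Proof.
split=> [/forallP h t ht|h].
  have /implyP := h t; apply; rewrite /bs_state [bs_law _ _]true_bddE.
  rewrite /F /= ffunE; apply/range_bdd_pair/agree_tracks => //; exact: kept_le.
apply/forallP => t; apply/implyP => /andP [_].
rewrite /F /= ffunE => /range_bdd_pair /agree_tracks ht.
by apply: h; apply: ht; apply: kept_le.
Qed.

Lemma sat_imp t phi psi :
  sat F t (Neg (And phi (Neg psi))) <-> (sat F t phi -> sat F t psi).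
Proof.
rewrite /= negb_and negbK; split; first by case/orP => // /negP.
by case: (sat F t phi) => // ->.
Qed.

Lemma sat_dia (i : 'I_3) t phi : sat F t (Neg (Know i (Neg phi))) <->
  exists2 t',
    (forall u, kept_lo i <= u < kept_lo i + kept_len i -> trk u t = trk u t')
    & sat F t' phi.
Proof.
split.
  move=> /existsP [t']; rewrite negb_imply => /andP [/andP [_ h1]]; rewrite negbK => h2.
  exists t' => //; move: h1; rewrite /F /= ffunE => /range_bdd_pair /agree_tracks.
  by apply; apply: kept_le.
case=> t' h1 h2; apply/negP => h.
by have /negP := (sat_know i t (Neg phi)).1 h t' h1; apply.
Qed.

Definition fm (phi : tf) : EL 'I_3 'I_natom.+1 := tform 3 natom w (benv z) phi.

Definition t_halves v :=
  tor (TAnd (t_eq v 3 0) (t_eq v 4 2)) (TAnd (t_eq v 3 2) (t_eq v 4 1)).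

Definition t_load v := TAnd (t_eq v 0 3) (t_eq v 1 4).

Definition ag0 : 'I_3 := inord 0.
Definition ag1 : 'I_3 := inord 1.
Definition ag2 : 'I_3 := inord 2.

Fixpoint reach (k : nat) : EL 'I_3 'I_natom.+1 :=
  if k is k'.+1 then
    Neg (Know ag0 (Neg (Know ag1 (Neg (And (fm (t_halves 3))
      (Neg (Know ag2 (Neg (And (fm (t_load 3)) (Neg (reach k')))))))))))
  else fm t_step.

Lemma sat_eq s t t' : sat F s (fm (t_eq 3 t t')) <-> trk t s = trk t' s.
Proof. by rewrite sat_tform tbev_eq. Qed.

Lemma sat_halves s : sat F s (fm (t_halves 3)) <->
  (trk 3 s = trk 0 s /\ trk 4 s = trk 2 s) \/ (trk 3 s = trk 2 s /\ trk 4 s = trk 1 s).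
Proof.
rewrite sat_tform tbev_or !tbev_and -!(@sat_tform 3 natom w (benv z) F s) -!sat_eq; split.
  by case/orP => /andP; [left|right].
by case=> [[-> ->]|[-> ->]] //; rewrite orbT.
Qed.

Lemma sat_load s : sat F s (fm (t_load 3)) <-> trk 0 s = trk 3 s /\ trk 1 s = trk 4 s.
Proof.
rewrite sat_tform tbev_and -!(@sat_tform 3 natom w (benv z) F s) -!sat_eq.
by split=> [/andP|[-> ->]].
Qed.

Lemma sat_step s cf : (forall j, cf_head cf j < P) -> trk 0 s = enc cf ->
  sat F s (fm t_step) <-> trk 1 s = enc (tm_step cf).
Proof.
move=> hP e0; rewrite sat_tform.
have x0 := (encP (fun k => (inord k : 'I_natom.+1) \in s) cf).2 e0.
rewrite (tbev_step z x0 hP) (encP (fun k => (inord (B + k) : 'I_natom.+1) \in s)).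
by rewrite /trk mul1n.
Qed.

(** The modalities turn into quantifiers over block contents: [m] is the midpoint Z, and [t] is any
    state into which a half has been loaded, its own block Z being arbitrary. *)
Lemma sat_reachS s k :
  sat F s (reach k.+1) <->
  exists m, size m = B /\ forall u v,
    (u = trk 0 s /\ v = m) \/ (u = m /\ v = trk 1 s) ->
    forall t, trk 0 t = u -> trk 1 t = v -> trk 3 t = u -> trk 4 t = v ->
      sat F t (reach k).
Proof.
have kept0 : (kept_lo ag0 = 0) * (kept_len ag0 = 2) by rewrite /ag0 inordK.
have kept1 : (kept_lo ag1 = 0) * (kept_len ag1 = 3) by rewrite /ag1 inordK.
have kept2 : (kept_lo ag2 = 3) * (kept_len ag2 = 2) by rewrite /ag2 inordK.
have tr t l : t < 5 -> size (nth [::] l t) = B -> trk t (of_tracks l) = nth [::] l t.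
  exact: trk_of_tracks.
rewrite [reach _]/= sat_dia !kept0; split.
  case=> t st /sat_know; rewrite !kept1 => h.
  exists (trk 2 t); split; first exact: size_trk.
  move=> u v huv t' t0 t1 t3 t4.
  have [szu szv] : size u = B /\ size v = B by rewrite -t0 -t1 !size_trk.
  (* The state offered to agent 1: X, Y, Z are kept, and the chosen half is written into U, V. *)
  pose t2 := of_tracks [:: trk 0 t; trk 1 t; trk 2 t; u; v].
  have tt2 i : 0 <= i < 0 + 3 -> trk i t = trk i t2.
    by case: i => [|[|[|i]]] // _; rewrite tr //= size_trk.
  have {h} /sat_imp h := h t2 tt2.
  have /sat_know h' : sat F t2 (Know ag2 (Neg (And (fm (t_load 3)) (Neg (reach k))))).
    by apply: h; apply/sat_halves; rewrite !tr ?size_trk //= -(st 0) // -(st 1).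
  have /sat_imp : sat F t' (Neg (And (fm (t_load 3)) (Neg (reach k)))).
    apply: h'; rewrite !kept2 => i hi.
    by have /orP [/eqP ->|/eqP ->] : (i == 3) || (i == 4); [lia| |]; rewrite tr //= ?t3 ?t4.
  by apply; apply/sat_load; rewrite t0 t1 t3 t4.
case=> m [szm h].
(* Agent 0 supplies the midpoint; U and V may be empty, since agent 1 ranges over them anew. *)
pose t1 := of_tracks [:: trk 0 s; trk 1 s; m; [::]; [::]].
exists t1; first by case=> [|[|i]] // _; rewrite tr //= size_trk.
apply/sat_know => t2; rewrite !kept1 => e2; apply/sat_imp => /sat_halves hv.
apply/sat_know => t3; rewrite !kept2 => e3; apply/sat_imp => /sat_load [l0 l1].
have e20 : trk 0 t2 = trk 0 s by rewrite -e2 // tr //= size_trk.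
have e21 : trk 1 t2 = trk 1 s by rewrite -e2 // tr //= size_trk.
have e22 : trk 2 t2 = m by rewrite -e2 // tr.
apply: (h (trk 3 t2) (trk 4 t2)); last 4 first.
- by rewrite l0 -e3.
- by rewrite l1 -e3.
- by rewrite -e3.
- by rewrite -e3.
by rewrite -e20 -e21 -e22.
Qed.

(** Only X is assumed to encode a configuration. The first half forces the midpoint to be the
    encoding after 2^k steps, so the induction hypothesis applies to the second half too. *)
Lemma sat_reach k s cf : (forall t j, cf_head (iter t (@tm_step M) cf) j < P) ->
  trk 0 s = enc cf ->
  sat F s (reach k) <-> trk 1 s = enc (iter (2 ^ k) (@tm_step M) cf).
Proof.
have tr t l : t < 5 -> size (nth [::] l t) = B -> trk t (of_tracks l) = nth [::] l t.
  exact: trk_of_tracks.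
elim: k s cf => [|k IH] s cf hP e0.
  by apply: sat_step => //; apply: (hP 0).
have hP' t j : cf_head (iter t (@tm_step M) (iter (2 ^ k) (@tm_step M) cf)) j < P.
  by rewrite -iterD.
have sz cf' : size (enc cf') = B by rewrite size_mkseq.
rewrite sat_reachS expnS mul2n -addnn iterD; split.
  case=> m [szm h].
  have em : m = enc (iter (2 ^ k) (@tm_step M) cf).
    pose t := of_tracks [:: trk 0 s; m; m; trk 0 s; m].
    have := h (trk 0 s) m (or_introl (conj erefl erefl)) t.
    rewrite !tr ?size_trk //= => /(_ erefl erefl erefl erefl).
    by rewrite (IH _ cf hP) tr ?size_trk.
  pose t := of_tracks [:: m; trk 1 s; m; m; trk 1 s].
  have := h m (trk 1 s) (or_intror (conj erefl erefl)) t.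
  rewrite !tr ?size_trk //= => /(_ erefl erefl erefl erefl).
  by rewrite (IH _ _ hP') tr ?size_trk.
move=> e1; exists (enc (iter (2 ^ k) (@tm_step M) cf)); split=> // u v huv t t0 t1 _ _.
case: huv => -[hu hv].
  by apply/(IH _ cf hP); rewrite ?t0 ?t1 ?hu ?hv.
by apply/(IH _ _ hP'); rewrite ?t0 ?t1 ?hu ?hv.
Qed.

(** Agent 2 keeps U and V only, so X and Y are chosen freely from any point; this is why [set0] can
    serve as the point. *)
Definition red_formula : EL 'I_3 'I_natom.+1 :=
  Neg (Know ag2 (Neg (And (fm t_inits) (And (fm t_accept) (reach B))))).

Lemma sat_red_formula : (forall t j, cf_head (tm_run M w t) j < P) ->
  sat F set0 red_formula <->
  tm_halt (cf_state (tm_run M w (2 ^ B))) = Some true.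
Proof.
move=> hP.
have kept2 : (kept_lo ag2 = 3) * (kept_len ag2 = 2) by rewrite /ag2 inordK.
have tr t l : t < 5 -> size (nth [::] l t) = B -> trk t (of_tracks l) = nth [::] l t.
  exact: trk_of_tracks.
have sz cf' : size (enc cf') = B by rewrite size_mkseq.
have body s : sat F s (And (fm t_inits) (And (fm t_accept) (reach B))) <->
    [/\ trk 0 s = enc (tm_init M w), trk 1 s = enc (tm_run M w (2 ^ B))
      & tm_halt (cf_state (tm_run M w (2 ^ B))) = Some true].
  have acc : trk 1 s = enc (tm_run M w (2 ^ B)) -> sat F s (fm t_accept) =
      (tm_halt (cf_state (tm_run M w (2 ^ B))) == Some true).
    by move=> e; rewrite sat_tform; apply: tbev_accept; rewrite -e /trk mul1n.
  split.
    move=> h; have /and3P [h0 ha hr] :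
      [&& sat F s (fm t_inits), sat F s (fm t_accept) & sat F s (reach B)] := h.
    have e0 : trk 0 s = enc (tm_init M w).
      by move: h0; rewrite sat_tform => /tbev_inits.
    have e1 : trk 1 s = enc (tm_run M w (2 ^ B)) by apply/(sat_reach _ hP).
    by split=> //; apply/eqP; rewrite -acc.
  case=> e0 e1 ha.
  suff: [&& sat F s (fm t_inits), sat F s (fm t_accept) & sat F s (reach B)] by [].
  apply/and3P; split; last by apply/(sat_reach _ hP).
    by rewrite sat_tform; apply/tbev_inits.
  by rewrite acc // ha.
rewrite sat_dia !kept2; split; first by case=> t _ /body [].
move=> ha; set z0 := trk 3 set0; set z1 := trk 4 set0.
exists (of_tracks [:: enc (tm_init M w); enc (tm_run M w (2 ^ B)); [::]; z0; z1]).
  move=> i hi; have /orP [/eqP ->|/eqP ->] : (i == 3) || (i == 4); [lia| |];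
    by rewrite tr //= size_trk.
by apply/body; split=> //; rewrite tr // [nth _ _ _]/= sz.
Qed.

(** The next level stands last in each level, so in prefix notation the code is a k-fold repetition,
    which one loop can print. *)
Lemma EL_code_reach k :
  EL_code (reach k) =
  flatten (nseq k ([:: 3; 5; 0; 3; 5; 1; 3; 4] ++ EL_code (fm (t_halves 3))
    ++ [:: 3; 5; 2; 3; 4] ++ EL_code (fm (t_load 3)) ++ [:: 3]))
  ++ EL_code (fm t_step).
Proof.
elim: k => [//|k IH].
have level a b r : EL_code (Neg (Know ag0 (Neg (Know ag1 (Neg (And a
      (Neg (Know ag2 (Neg (And b (Neg r))))))))))) =
    ([:: 3; 5; 0; 3; 5; 1; 3; 4] ++ EL_code a ++ [:: 3; 5; 2; 3; 4]
      ++ EL_code b ++ [:: 3]) ++ EL_code r.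
  by rewrite /ag0 /ag1 /ag2 /= !inordK // -!catA /= -!catA.
have unfold (p : seq nat) : flatten (nseq k.+1 p) = p ++ flatten (nseq k p) by [].
by rewrite unfold -[RHS]catA -IH; apply: level.
Qed.

End Formula.

(** * Printing the instance *)

Lemma map_cst (T U : Type) (s : seq T) (x : U) : [seq x | _ <- s] = nseq (size s) x.
Proof. by elim: s => //= y s ->. Qed.

Definition gouts := foldr (fun p g => GCat (GOut p.1 p.2) g) GNil.

Lemma den_gouts env l : den w env (gouts l) = [seq lin env p.1 p.2 | p <- l].
Proof. by elim: l => //= p l ->. Qed.

Definition gconsts l := gouts [seq (k, [::]) | k <- l].

Lemma den_gconsts env l : den w env (gconsts l) = l.
Proof. by rewrite den_gouts -map_comp; elim: l => //= k l ->; rewrite /lin addn0. Qed.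

(** [lo] lists variables whose sum is the first atom. Inside the loop index 0 is the pair number k
    and the others shift by one, so [lo2] denotes twice the sum of [lo] and k. *)
Definition grange (lo : seq nat) (v : nat) :=
  let lo2 := [:: 0; 0] ++ [seq x.+1 | x <- lo ++ lo] in
  let len3 := nseq 3 v.+1 in
  GCat (gouts [:: (2, nseq 3 v); (0, [::])])
    (GCat (GFor v (gouts
       [:: (2, [::]); (0, lo2); (1, nseq 3 0); (2, nseq 3 0);
           (2, [::]); (1, lo2); (3, nseq 3 0); (1, len3);
           (2, [::]); (1, lo2); (1, len3); (3, nseq 3 0)]))
      (gconsts [:: 1; 0])).

Lemma den_grange env lo v :
  den w env (grange lo v) =
  let len := nth 0 env v in let l := lin env 0 lo in
  [:: (3 * len).+2, 0 &
    flatten [seq [:: 2; 2 * (l + k); 3 * k + 1; 3 * k + 2;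
                  2; (2 * (l + k)).+1; 3 * k + 3; (3 * len).+1;
                  2; (2 * (l + k)).+1; (3 * len).+1; 3 * k + 3]
            | k <- iota 0 len] ++ [:: 1; 0]].
Proof.
have e1 : lin env 2 (nseq 3 v) = (3 * nth 0 env v).+2 by rewrite /lin /=; lia.
have e2 : lin env 0 [::] = 0 by [].
rewrite [LHS]/= -/(nseq 3 v) e1 e2; congr [:: _, _ & _ ++ _].
congr flatten; apply: eq_map => k.
have e3 j : lin (k :: env) j ([:: 0; 0] ++ [seq x.+1 | x <- lo ++ lo]) =
    j + 2 * (lin env 0 lo + k).
  rewrite /lin map_cat sumn_cat -map_comp map_cat sumn_cat /=.
  by move: (sumn _) => y; lia.
have e4 j : lin (k :: env) j (nseq 3 0) = 3 * k + j by rewrite /lin /=; lia.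
have e5 j : lin (k :: env) j (nseq 3 v.+1) = 3 * nth 0 env v + j by rewrite /lin /=; lia.
have e6 : lin (k :: env) 2 [::] = 2 by [].
by rewrite !e3 !e4 !e5 e6 add0n !add1n !addn1.
Qed.

Definition gformula :=
  GCat (gconsts [:: 3; 5; 2; 3; 4])
    (GCat (tgen t_inits) (GCat (gconsts [:: 4])
      (GCat (tgen t_accept)
        (GCat (GFor 3
                 (GCat (gconsts [:: 3; 5; 0; 3; 5; 1; 3; 4])
                   (GCat (tgen (t_halves 4))
                     (GCat (gconsts [:: 3; 5; 2; 3; 4])
                       (GCat (tgen (t_load 4)) (gconsts [:: 3]))))))
           (tgen t_step))))).

Lemma den_gformula z : den w (benv z) gformula = EL_code (red_formula z).
Proof.
have body i : den w (i :: benv z)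
     (GCat (gconsts [:: 3; 5; 0; 3; 5; 1; 3; 4])
       (GCat (tgen (t_halves 4))
         (GCat (gconsts [:: 3; 5; 2; 3; 4])
           (GCat (tgen (t_load 4)) (gconsts [:: 3]))))) =
    [:: 3; 5; 0; 3; 5; 1; 3; 4] ++ EL_code (fm z (t_halves 3))
    ++ [:: 3; 5; 2; 3; 4] ++ EL_code (fm z (t_load 3)) ++ [:: 3].
  have eq_ok t t' : t < 5 -> t' < 5 -> tok natom w (i :: benv z) (t_eq 4 t t').
    exact: tok_eq.
  have e : nth 0 (i :: benv z) 4 = nth 0 (benv z) 3 by [].
  have eqE t t' : tform 3 natom w (i :: benv z) (t_eq 4 t t') = fm z (t_eq 3 t t').
    exact: tform_eq.
  have h1 : den w (i :: benv z) (tgen (t_halves 4)) = EL_code (fm z (t_halves 3)).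
    rewrite (@den_tgen 3 natom); last by rewrite tok_or !tok_and !eq_ok.
    by congr EL_code; rewrite /fm /t_halves /tor [LHS]/= -!/(t_eq _ _ _) !eqE.
  have h2 : den w (i :: benv z) (tgen (t_load 4)) = EL_code (fm z (t_load 3)).
    rewrite (@den_tgen 3 natom); last by rewrite tok_and !eq_ok.
    by congr EL_code; rewrite /fm /t_load [LHS]/= -!/(t_eq _ _ _) !eqE.
  have den_cat g g' : den w (i :: benv z) (GCat g g') =
      den w (i :: benv z) g ++ den w (i :: benv z) g' by [].
  by rewrite den_cat den_gconsts den_cat h1 den_cat den_gconsts den_cat h2 den_gconsts.
have den_cat g g' : den w (benv z) (GCat g g') = den w (benv z) g ++ den w (benv z) g'.
  by [].
have loop : den w (benv z) (GFor 3
                 (GCat (gconsts [:: 3; 5; 0; 3; 5; 1; 3; 4])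
                   (GCat (tgen (t_halves 4))
                     (GCat (gconsts [:: 3; 5; 2; 3; 4])
                       (GCat (tgen (t_load 4)) (gconsts [:: 3])))))) =
    flatten (nseq B ([:: 3; 5; 0; 3; 5; 1; 3; 4] ++ EL_code (fm z (t_halves 3))
      ++ [:: 3; 5; 2; 3; 4] ++ EL_code (fm z (t_load 3)) ++ [:: 3])).
  rewrite -(size_iota 0 B) -map_cst; congr flatten.
  by apply: eq_map => i; apply: body.
have h1 : den w (benv z) (tgen t_inits) = EL_code (fm z t_inits).
  exact/den_tgen/tok_inits.
have h2 : den w (benv z) (tgen t_accept) = EL_code (fm z t_accept).
  exact/den_tgen/tok_accept.
have h3 : den w (benv z) (tgen t_step) = EL_code (fm z t_step).
  exact/den_tgen/tok_step.
rewrite /gformula den_cat den_gconsts den_cat h1 den_cat den_gconsts den_cat h2.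
rewrite den_cat loop h3 -EL_code_reach.
have top a b r : EL_code (Neg (Know ag2 (Neg (And a (And b r))))) =
    [:: 3; 5; 2; 3; 4] ++ EL_code a ++ [:: 4] ++ EL_code b ++ EL_code r.
  by rewrite /ag2 /= inordK.
exact/esym/top.
Qed.

Definition ginstance :=
  GCat (gouts [:: (3, [::]); (0, [:: 0]); (1, [::]); (0, [::]); (1, [::])])
    (GCat (GCat (grange [::] 2) (GCat (grange [::] 1) (grange [:: 1] 2)))
      (GCat (GFor 0 (gconsts [:: 0])) gformula)).

Lemma den_ginstance z :
  den w (benv z) ginstance = mc_code (red_instance (red_formula z)).
Proof.
have den_cat g g' : den w (benv z) (GCat g g') = den w (benv z) g ++ den w (benv z) g'.
  by [].
rewrite /mc_code /red_instance /mc_law /mc_obs /mc_point /mc_formula /mc_agents /mc_atoms.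
rewrite true_bdd_code /ginstance den_cat.
have -> : den w (benv z) (gouts [:: (3, [::]); (0, [:: 0]); (1, [::]); (0, [::]); (1, [::])])
   = [:: 3; natom.+1; 1; 0; 1].
  by rewrite den_gouts /lin /= !addn0 !add0n.
rewrite den_cat den_cat (den_cat (grange [::] 1)) den_cat den_gformula.
have -> : den w (benv z) (GFor 0 (gconsts [:: 0])) =
    [seq nat_of_bool (p \in (set0 : {set 'I_natom.+1})) | p <- enum 'I_natom.+1].
  transitivity (nseq natom.+1 0).
    have -> : den w (benv z) (GFor 0 (gconsts [:: 0])) =
      flatten [seq [:: 0] | _ <- iota 0 natom.+1] by [].
    by rewrite map_cst size_iota; elim: natom.+1 => //= k ->.
  rewrite -[in LHS](size_enum_ord natom.+1) -map_cst.
  by apply: eq_map => p; rewrite inE.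
have -> : [seq bdd_code (@primed_code natom.+1) ([ffun i => obs_bdd i] i) | i <- enum 'I_3]
  = [:: den w (benv z) (grange [::] 2); den w (benv z) (grange [::] 1);
        den w (benv z) (grange [:: 1] 2)].
  have code (i : 'I_3) lo v : nth 0 (benv z) v = kept_len i * B ->
      lin (benv z) 0 lo = kept_lo i * B ->
      bdd_code (@primed_code natom.+1) ([ffun i => obs_bdd i] i) =
      den w (benv z) (grange lo v).
    by move=> e1 e2; rewrite ffunE range_bdd_code den_grange e1 e2.
  have -> : enum 'I_3 = [:: ag0; ag1; ag2].
    by apply: (inj_map val_inj); rewrite val_enum_ord /= !inordK.
  rewrite -(code ag0 [::] 2); [|by rewrite /ag0 inordK..].
  rewrite -(code ag1 [::] 1); [|by rewrite /ag1 inordK..].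
  by rewrite -(code ag2 [:: 1] 2) // /ag2 inordK // /lin /= addn0.
by rewrite [flatten _]/= cats0 -!catA.
Qed.

(** The environment after [k] multiplications: the latest power is on top and the factor n has moved
    to index [k.+1]. The exponent c is a constant of the reduction, so n^c takes a fixed nesting of
    [GMul]. *)
Fixpoint powers k := if k is k'.+1 then n ^ k :: powers k' else [:: 1; n].

Fixpoint gpowers (m k : nat) (g : gen) :=
  if m is m'.+1 then GMul 0 k.+1 (gpowers m' k.+1 g) else g.

Lemma powers_head k : nth 0 (powers k) 0 = n ^ k.
Proof. by case: k. Qed.

Lemma powers_base k : nth 0 (powers k) k.+1 = n.
Proof. by elim: k. Qed.

Lemma den_gpowers m k g :
  den w (powers k) (gpowers m k g) = den w (powers (k + m)) g.
Proof.
elim: m k => [|m IH] k; first by rewrite addn0.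
by rewrite addnS -addSn -IH /= powers_head powers_base -expnSr.
Qed.

(** Pushes the entries of [benv] from the last to the first. Generators cannot subtract, so [P - n]
    is obtained as c n^c + c + 2, and [P.-2] and [P.-1] come before [P]. *)
Definition greduction :=
  GLet 1 [::] (gpowers c 0 (GLet c (nseq c 0) (GLet 0 [:: c.+2] (GLet 2 [:: 1]
  (GLet 0 [:: 1; 2] (GLet 1 [:: 0] (GLet 1 [:: 0] (GLet 0 (nseq nfeat 0)
  (GLet 0 [:: 0; 0] (GLet 0 [:: 0; 1] (GLet 1 [:: 0; 1] ginstance))))))))))).

Definition scratch_values := c * n ^ c + c :: powers c.

Lemma den_greduction :
  den w [:: n] greduction = mc_code (red_instance (red_formula scratch_values)).
Proof.
rewrite -den_ginstance /greduction.
have step env k vs x g : lin env k vs = x -> den w env (GLet k vs g) = den w (x :: env) g.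
  by move=> <-.
have lin_rep env k m v : lin env k (nseq m v) = k + m * nth 0 env v.
  by rewrite -[nseq _ _]cats0 lin_nseq_cat /lin /= !addn0.
rewrite (step _ _ _ 1) // -/(powers 0) den_gpowers add0n.
rewrite (step _ _ _ (c * n ^ c + c)); last by rewrite lin_rep powers_head addnC.
rewrite -/scratch_values (step _ _ _ n); last by rewrite /lin /scratch_values /= powers_base addn0.
rewrite (step _ _ _ (P - n)); last by rewrite /lin /scratch_values /= /P /space; lia.
rewrite (step _ _ _ P.-2); last by rewrite /lin /scratch_values /= addn0.
rewrite (step _ _ _ P.-1); last by rewrite /lin /= addn0 add1n.
rewrite (step _ _ _ P); last by rewrite /lin /= addn0 add1n.
rewrite (step _ _ _ B); last by rewrite lin_rep.
rewrite (step _ _ _ (2 * B)); last by rewrite /lin /=; lia.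
rewrite (step _ _ _ (3 * B)); last by rewrite /lin /=; lia.
by rewrite (step _ _ _ (5 * B).+1) //; rewrite /lin /=; lia.
Qed.

End Reduction.

Theorem theorem5 : PSPACE_hard EL_model_checking.
Proof.
move=> L [M [S [[c hS] hspace hdec]]].
exists (fun w => red_instance (red_formula M c w (scratch_values c w)) :
  dp_instance EL_model_checking).
split.
  have [M' [T [hT hcomp]]] := gen_polytime (greduction M c).
  exists M', T; split=> // w; have [t [h1 h2 h3]] := hcomp w.
  by exists t; split=> // i; rewrite h3 den_greduction.
move=> w.
have hP t j : cf_head (tm_run M w t) j < space c w.
  apply: leq_trans (hspace w t j) _; apply: leq_trans (hS _) _.
  by rewrite /space; lia.
apply: iff_trans _ (iff_sym (sat_red_formula (scratch_values c w) hP)).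
(* The halting time given by [hdec] is arbitrary; [halts_early] carries its verdict to time 2^B. *)
have [t [b [hb ->]]] := hdec w.
rewrite (halts_early hP hb).
by split=> [->|[->]].
Qed.
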